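(* Let $Y=H_2(N)=N^2-1$, where $N\sim N(0,1)$. Then $\mathrm{PSO}(Y)=\langle G\rangle_{A_1(\mathbb{R})}=\{GL:L\in A_1(\mathbb{R})\}$, where the generator is $G=-y+2(y+1)\partial$.
   Context: $A_1(\mathbb{R})$ is the first Weyl algebra, here in the variable $y$: the ring of linear differential operators $\sum_{t=0}^T p_t(y)\partial^t$ with $p_t\in\mathbb{R}[y]$, $\partial=\frac{d}{dy}$, with composition as multiplication. Polynomial Stein operators. For a continuous real-valued random variable $Y$ and a class $\mathcal{F}$ of functions, an operator $S=\sum_{t=0}^{T}p_t\partial^t$ ($T\ge1$, $p_t$ real polynomials) is a polynomial Stein operator for $Y$ if $Sf\in L^1(Y)$ (i.e. $\mathbb{E}|Sf(Y)|<\infty$) and $\mathbb{E}[Sf(Y)]=0$ for all $f\in\mathcal{F}$; $\mathrm{PSO}_{\mathcal{F}}(Y)$ is the set of all of them (it contains $0$), and $\mathrm{PSO}(Y)$ is shorthand for $\mathrm{PSO}_{\mathcal{F}}(Y)$. Convention: $\mathcal{F}$ is the Schwartz class $\mathcal{S}(\mathbb{R})$; when, as here, all moments of the target random variable exist, the results are also asserted for $\mathcal{F}=\mathbb{R}[y]$, for $\mathcal{F}=P(\mathbb{R})=\{f\in C^\infty(\mathbb{R}):\sup_{x}|(1+x^\alpha)^{-1}\partial^\beta f(x)|<\infty$ for all $\beta\in\mathbb{N}_0$ and some $\alpha\ge1\}$, and for the operator-dependent class of all $f\in C^T(I)$ ($I$ the support of $Y$) with $\mathbb{E}|Y^jf^{(t)}(Y)|<\infty$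 for $0\le j\le \max_t\deg p_t$, $0\le t\le T$. *)

(* Defs.v *)
From HB Require Import structures.
From mathcomp Require Import all_boot all_order all_algebra.
From mathcomp Require Import all_classical all_reals all_analysis.

Set Implicit Arguments.
Unset Strict Implicit.
Unset Printing Implicit Defensive.

Import Order.TTheory GRing.Theory Num.Theory.
Import numFieldNormedType.Exports.

Local Open Scope classical_set_scope.
Local Open Scope ring_scope.

(* The first Weyl algebra A_1(R).  The operator \sum_t p_t(y) d^t is stored in
   normal form, as the polynomial in d whose t-th coefficient is p_t, so that
   S`_t is p_t and (size S).-1 is the order of S.  Only the additive structure
   is that of {poly {poly R}}; the product, defined below, is composition. *)
Definition weyl (R : numDomainType) := {poly {poly R}}.

HB.instance Definition _ (R : numDomainType) :=
  GRing.Zmodule.copy (weyl R) {poly {poly R}}.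

Section WeylAlgebra.
Variable R : numDomainType.
Implicit Types (S L M : {poly {poly R}}) (f : {poly R}).

(* d \o (\sum_t q_t d^t) = \sum_t (q_t d^t.+1 + q_t' d^t) *)
Definition wdcomp L : {poly {poly R}} := L * 'X + map_poly (@deriv R) L.

Definition wmul S L : {poly {poly R}} :=
  \sum_(s < size S) S`_s *: iter s wdcomp L.

(* The (faithful) action of L on R[y]; it shows that wmul is composition. *)
Definition wpact L f : {poly R} := \sum_(t < size L) L`_t * f^`(t).

Lemma wpact_wide n L f : (size L <= n)%N ->
  wpact L f = \sum_(t < n) L`_t * f^`(t).
Proof.
move=> Ln; rewrite /wpact (big_ord_widen _ (fun t => L`_t * f^`(t)) Ln).
rewrite big_mkcond /=; apply: eq_bigr => t _; case: ltnP => // Lt.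
by rewrite nth_default// mul0r.
Qed.

Lemma wpactD L M f : wpact (L + M) f = wpact L f + wpact M f.
Proof.
pose n := maxn (size L) (size M).
rewrite (@wpact_wide n (L + M)) ?size_polyD//.
rewrite (@wpact_wide n L) ?leq_maxl// (@wpact_wide n M) ?leq_maxr//.
by rewrite -big_split; apply: eq_bigr => t _; rewrite coefD mulrDl.
Qed.

Lemma wpactN L f : wpact (- L) f = - wpact L f.
Proof.
rewrite /wpact size_polyN -sumrN.
by apply: eq_bigr => t _; rewrite coefN mulNr.
Qed.

Lemma wpactZ (p : {poly R}) L f : wpact (p *: L) f = p * wpact L f.
Proof.
rewrite (@wpact_wide (size L)) ?size_scale_leq// /wpact mulr_sumr.
by apply: eq_bigr => t _; rewrite coefZ mulrA.
Qed.

Lemma wpact_sum n (F : 'I_n -> {poly {poly R}}) f :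
  wpact (\sum_i F i) f = \sum_i wpact (F i) f.
Proof.
elim/big_ind2: _ => //; first by rewrite /wpact size_poly0 big_ord0.
by move=> ? ? ? ? <- <-; rewrite wpactD.
Qed.

Lemma wpact_wdcomp L f : wpact (wdcomp L) f = (wpact L f)^`().
Proof.
have sX : (size (L * 'X)%R <= (size L).+1)%N.
  by rewrite (leq_trans (size_polyMleq _ _))// size_polyX addn2.
rewrite /wdcomp wpactD (@wpact_wide (size L).+1)// big_ord_recl coefMX/= mul0r.
rewrite add0r (@wpact_wide (size L) (map_poly _ _)); last first.
  by rewrite (leq_trans (size_poly _ _)).
rewrite -big_split /wpact raddf_sum; apply: eq_bigr => t _ /=.
by rewrite coefMX/= coef_map/= derivM addrC.
Qed.

Lemma wpact_inj L M : (forall f, wpact L f = wpact M f) -> L = M.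
Proof.
move=> LM; apply/eqP; rewrite -subr_eq0; apply/eqP.
have {LM} : forall f, wpact (L - M) f = 0.
  by move=> f; rewrite wpactD wpactN LM subrr.
move: (L - M) => K K0; apply/polyP => n; rewrite coef0.
elim/ltn_ind: n => n IHn; move: (K0 'X^n).
rewrite (@wpact_wide (n.+1 + size K)) ?leq_addl//.
rewrite big_split_ord big_ord_recr /= !big1 => [||i _]; first last.
- by rewrite IHn ?mul0r// ltn_ord.
- move=> i _; rewrite -[RHS](mulr0 K`_(n.+1 + i)); congr (_ * _).
  by apply: (@derivn_poly0 _ _ (n.+1 + i)); rewrite size_polyXn leq_addr.
rewrite add0r addr0 derivnXn subnn expr0 ffactnn => /eqP.
rewrite mulf_eq0 => /orP[/eqP//|].
by rewrite -polyC1 -polyCMn polyC_eq0 pnatr_eq0 eqn0Ngt fact_gt0.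
Qed.

Lemma wpactM S L f : wpact (wmul S L) f = wpact S (wpact L f).
Proof.
rewrite wpact_sum; apply: eq_bigr => s _; rewrite wpactZ; congr (_ * _).
by elim: (nat_of_ord s) => //= n IHn; rewrite wpact_wdcomp IHn.
Qed.

Lemma wpactDr L f g : wpact L (f + g) = wpact L f + wpact L g.
Proof.
by rewrite -big_split; apply: eq_bigr => t _; rewrite derivnD mulrDr.
Qed.

Lemma wpact1 f : wpact 1 f = f.
Proof. by rewrite /wpact size_poly1 big_ord1 coefC mul1r. Qed.

Lemma wmulA : associative wmul.
Proof. by move=> S L M; apply: wpact_inj => f; rewrite !wpactM. Qed.

Lemma wmul1l : left_id 1 wmul.
Proof. by move=> S; apply: wpact_inj => f; rewrite wpactM wpact1. Qed.

Lemma wmul1r : right_id 1 wmul.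
Proof. by move=> S; apply: wpact_inj => f; rewrite wpactM wpact1. Qed.

Lemma wmulDl : left_distributive wmul +%R.
Proof.
by move=> S L M; apply: wpact_inj => f; rewrite !(wpactM, wpactD).
Qed.

Lemma wmulDr : right_distributive wmul +%R.
Proof.
move=> S L M; apply: wpact_inj => f.
by rewrite !(wpactM, wpactD) wpactDr.
Qed.

Lemma wone_neq0 : 1 != 0 :> {poly {poly R}}.
Proof. exact: oner_neq0. Qed.

HB.instance Definition _ := GRing.Zmodule_isNzRing.Build (weyl R)
  wmulA wmul1l wmul1r wmulDl wmulDr wone_neq0.

Definition weyl_y : weyl R := 'X%:P.
Definition weyl_d : weyl R := 'X.

End WeylAlgebra.

Arguments weyl_y {R}.
Arguments weyl_d {R}.

Definition right_ideal1 (A : pzRingType) (G : A) : set A :=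
  [set G * L | L in [set: A]].

Section SteinOperators.
Context {R : realType}.
Implicit Types (S : weyl R) (f : R -> R) (I : set R).

(* S f, where [df t] is the t-th derivative of f *)
Definition weyl_apply S (df : nat -> R -> R) : R -> R :=
  fun y => \sum_(t < size S) (S`_t).[y] * df t y.

Definition smooth f := forall n x, derivable (derive1n n f) x 1.

Definition schwartz : set (R -> R) :=
  [set f | smooth f /\
    forall j k : nat, exists M : R, forall x : R,
      `|x ^+ j * derive1n k f x| <= M].

Definition polynomial_fun : set (R -> R) :=
  [set f | exists p : {poly R}, f = horner p].

(* |x| instead of x in the weight: x^alpha is not defined for x < 0 when alpha
   is not an integer, and 1 + x^alpha vanishes at -1 when alpha is odd. *)
Definition slow_growth : set (R -> R) :=
  [set f | smooth f /\
    forall b : nat, exists2 a : R, 1 <= a &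
      exists M : R, forall x : R,
        `|(1 + `|x| `^ a)^-1 * derive1n b f x| <= M].

(* Derivatives relative to I, one-sided at the endpoints of an interval I. *)
Definition derive1_within I f : R -> R :=
  fun x => lim ((f y - f x) / (y - x) @[y --> within I x^']).

Definition derive1n_within I (n : nat) f : R -> R :=
  iter n (derive1_within I) f.

Definition continuously_derivable I (n : nat) f :=
  (forall (t : nat) (x : R), (t < n)%N -> I x ->
     cvg ((derive1n_within I t f y - derive1n_within I t f x) / (y - x)
            @[y --> within I x^'])) /\
  (forall t : nat, (t <= n)%N -> {within I, continuous (derive1n_within I t f)}).

Section PSO.
Context d {T : measurableType d} (P : probability T R) (Y : {RV P >-> R}).

Definition rv_support : set R :=
  [set x | forall U : set R, open U -> U x -> (0 < distribution P Y U)%E].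

Definition stein_identity S (df : nat -> R -> R) :=
  P.-integrable [set: T] (fun w => (weyl_apply S df (Y w))%:E) /\
  'E_P[fun w => weyl_apply S df (Y w)]%E = 0%E.

Definition PSO (F : set (R -> R)) : set (weyl R) :=
  [set S | forall f, F f -> stein_identity S (fun t => derive1n t f)].

(* The order bound of the representation of S.  It has to be at least 1, also
   when S is 0 or multiplication by a polynomial. *)
Definition order_bound S : nat := maxn 1 (size S).-1.

Definition coef_degree S : nat :=
  (\max_(t < size S) (size (S`_t)%R).-1)%N.

Definition operator_class S : set (R -> R) :=
  [set f | continuously_derivable rv_support (order_bound S) f /\
    forall j t : nat, (j <= coef_degree S)%N -> (t <= order_bound S)%N ->
      P.-integrable [set: T]
        (fun w => (Y w ^+ j * derive1n_within rv_support t f (Y w))%:E)].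

Definition PSO_operator_class : set (weyl R) :=
  [set S | forall f, operator_class S f ->
     stein_identity S (fun t => derive1n_within rv_support t f)].

End PSO.

End SteinOperators.

(* Main.v *)
Require Import Defs.
From HB Require Import structures.
From mathcomp Require Import all_boot all_order all_algebra.
From mathcomp Require Import all_classical all_reals all_analysis.
From mathcomp Require Import measurable_realfun ring lra.

Set Implicit Arguments.
Unset Strict Implicit.
Unset Printing Implicit Defensive.

Import Order.TTheory GRing.Theory Num.Theory.
Import numFieldNormedType.Exports.

Local Open Scope classical_set_scope.
Local Open Scope ring_scope.

(* Put Z = Y + 1 = N^2.  Gaussian integration by parts applied to n h(n^2 - 1)
   shows that E[(G h)(Y)] = 0, which with h = L f gives one inclusion; the
   boundary terms at infinity vanish because Y h(Y) is integrable, the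
   coefficients of L having smaller degree than those of G L.
   Conversely, modulo the right ideal of G every operator reduces to
   p(y) + sum_t c_t d^t with constants c_t.  If it is a Stein operator, test it
   on z^n: since E[Z^(n+1)] = (2 n + 1) E[Z^n], dividing by E[Z^n] gives a
   rational function of n that vanishes at all integers, but that has a pole at
   n = t - 1/2 for the largest t > 0 with c_t <> 0; so all these c_t vanish, and
   evaluating at n = - k - 1/2 then kills p.  A Stein operator for the Schwartz
   class is one for polynomials p by passing to the limit in p(x) exp(- e x^2). *)

(** * The right ideal of [G] *)

Definition chi2_gen (R : numDomainType) : weyl R :=
  - weyl_y + 2 * (weyl_y + 1) * weyl_d.

Section algebra.
Variable R : realFieldType.
Implicit Types (S L : weyl R) (f p : {poly R}).

Local Notation G := (chi2_gen R).

Lemma wpact_weylM S L f : wpact (S * L) f = wpact S (wpact L f).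
Proof. exact: wpactM. Qed.

Lemma wpactC p f : wpact p%:P f = p * f.
Proof.
by rewrite (@wpact_wide _ 1%N) ?size_polyC ?leq_b1// big_ord1 coefC.
Qed.

Lemma wpact_d f : wpact weyl_d f = f^`().
Proof.
by rewrite /wpact size_polyX !big_ord_recl big_ord0 !coefX/= mul0r add0r mul1r addr0.
Qed.

Lemma wpact_gen f : wpact G f = - ('X * f) + 2 * ('X + 1) * f^`().
Proof.
rewrite /chi2_gen wpactD wpactN wpactC wpact_weylM wpact_d wpact_weylM.
rewrite [2]mulr2n wpactD !wpact1 wpactD wpactC wpact1; ring.
Qed.

(** The action on polynomials is faithful, so this normal form is found by comparing actions instead
    of expanding the product. *)
Lemma gen_mulE L :
  G * L = - ('X *: (L : {poly {poly R}})) + (2 * ('X + 1)) *: wdcomp L.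
Proof.
apply: wpact_inj => f.
by rewrite wpact_weylM wpact_gen wpactD wpactN !wpactZ wpact_wdcomp.
Qed.

(** Left division by [G], by induction on the order. Writing p = p(-1) + (y + 1) r, the part (y + 1)
    r d^(t+1) is the top term of an element of the ideal and so reduces to order t; only the
    constant p(-1) stays in front of d^(t+1). *)
Lemma gen_normal_form S : exists L : weyl R, exists p, exists C : {poly R},
  S = G * L + (p%:P + map_poly polyC C : {poly {poly R}}) :> weyl R.
Proof.
pose N S := exists L : weyl R, exists p, exists C : {poly R},
  S = G * L + (p%:P + map_poly polyC C : {poly {poly R}}) :> weyl R.
have ND S1 S2 : N S1 -> N S2 -> N (S1 + S2).
  move=> [L1 [p1 [C1 ->]]] [L2 [p2 [C2 ->]]].
  exists (L1 + L2), (p1 + p2), (C1 + C2).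
  rewrite mulrDr [LHS]addrACA; congr (_ + _).
  rewrite polyCD rmorphD/=; exact: (@addrACA {poly {poly R}}).
have N0 : N 0.
  exists 0, 0, 0; rewrite mulr0 add0r map_poly0 polyC0.
  by rewrite (@addr0 {poly {poly R}}).
suff NM t : forall p, N (p *: 'X^t : {poly {poly R}}).
  suff : N S by [].
  rewrite -[S](@coefK) poly_def.
  by apply: (big_ind N) => // i _; exact: NM.
elim: t => [|t IH] p.
  exists 0, p, 0; rewrite mulr0 add0r map_poly0.
  by rewrite (@addr0 {poly {poly R}}) expr0 -mul_polyC mulr1.
have [r pE] : exists r, p = p.[-1]%:P + ('X + 1) * r.
  have /factor_theorem[r pr] : root (p - p.[-1]%:P) (-1).
    by rewrite /root hornerD hornerN hornerC subrr.
  have X1 : 'X + 1 = 'X - (-1)%:P :> {poly R} by rewrite polyCN opprK.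
  by exists r; rewrite X1 mulrC -pr addrC subrK.
(* G M = (y + 1) r d^(t+1) + ((y + 1) r' - y r / 2) d^t, and [q] cancels the term of order t. *)
pose M : {poly {poly R}} := (2^-1 *: r) *: 'X^t.
pose c : {poly R} := (p.[-1])%:P.
pose q : {poly R} := 2^-1 *: ('X * r) - ('X + 1) * r^`().
have -> : (p *: 'X^(t.+1) : {poly {poly R}}) =
    (c *: 'X^(t.+1) : {poly {poly R}}) + ((G * M : weyl R) + (q *: 'X^t : {poly {poly R}})).
  rewrite gen_mulE /wdcomp [in LHS]pE scalerDl; congr (_ + _).
  apply/polyP => i; rewrite !(coefD, coefZ, coefN, coefMX, coefXn).
  rewrite coef_map/= coefZ coefXn.
  have h2 : 2^-1%:P * 2 = 1 :> {poly R}.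
    by rewrite -(polyC_natr R 2) -polyCM mulVf ?pnatr_eq0.
  have dn (n : nat) : (n%:R : {poly R})^`() = 0 by rewrite -polyC_natr derivC.
  rewrite /q -!mul_polyC.
  by case: i => [|i] /=;
    rewrite ?eqSS ?(mulr0, mul0r, deriv0, derivM, derivC, dn); ring: h2.
apply: (ND _ _).
  exists 0, 0, (p.[-1] *: 'X^(t.+1)).
  rewrite mulr0 add0r polyC0 (@add0r {poly {poly R}}).
  by rewrite map_polyZ/= map_polyXn.
apply: (ND _ _); last exact: IH.
exists M, 0, 0.
by rewrite map_poly0 polyC0 (@addr0 {poly {poly R}}) addr0.
Qed.
End algebra.

(** * Operators annihilated by a functional that kills the image of [G] *)

Section annihilator.
Variable R : realFieldType.
Implicit Types (S L : weyl R) (f p : {poly R}).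
Local Notation G := (chi2_gen R).

Lemma poly_nat_roots_eq0 p : (forall n : nat, p.[n%:R] = 0) -> p = 0.
Proof.
move=> p0; apply/eqP; apply: contraT => pN0.
have := @max_poly_roots R p [seq n%:R | n <- iota 0 (size p)] pN0.
rewrite size_map size_iota ltnn => ->//.
  by apply/allP => _ /mapP[n _ ->]; rewrite /root p0.
rewrite map_inj_uniq ?iota_uniq// => i j /eqP.
by rewrite eqr_nat => /eqP.
Qed.

Lemma derivn_Xadd1 n t :
  (('X + 1 : {poly R}) ^+ n)^`(t) = ('X + 1) ^+ (n - t) *+ n ^_ t.
Proof.
elim: t => [|t IH]; first by rewrite derivn0 ffactn0 subn0.
rewrite derivnS IH derivMn deriv_exp derivD derivX derivC addr0 mul1r.
by rewrite -mulrnA ffactnSr mulnC subnS.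
Qed.

(** Here [lam] stands for the expectation of p(Y). Its values on the powers of y + 1 are determined
    up to the factor [lam 1] by the vanishing on the image of [G], which turns the converse
    inclusion into algebra. *)
Lemma chi2_annihilator (lam : {poly R} -> R) S :
  (forall a u v, lam (a *: u + v) = a * lam u + lam v) ->
  lam 1 != 0 -> (forall f, lam (wpact G f) = 0) ->
  (forall f, lam (wpact S f) = 0) -> right_ideal1 G S.
Proof.
move=> lamP lam1 lamG lamS.
have lam0 : lam 0 = 0.
  by have := lamP (-1) 0 0; rewrite scaler0 add0r mulN1r addNr.
have lamD u v : lam (u + v) = lam u + lam v by rewrite -[u]scale1r lamP mul1r scale1r.
have lamZ a u : lam (a *: u) = a * lam u by rewrite -[a *: u]addr0 lamP lam0 addr0.
have lam_sum n (F : 'I_n -> {poly R}) : lam (\sum_i F i) = \sum_i lam (F i).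
  by apply: big_morph.
(* The moments of Z = y + 1. Applied to Z^n, the generator gives - Z^(n+1) + (2 n + 1) Z^n, whence
   the recursion [mS]. *)
pose m n := lam (('X + 1) ^+ n).
have mS n : m n.+1 = (2 * n%:R + 1) * m n.
  have := lamG (('X + 1) ^+ n); rewrite wpact_gen deriv_exp derivD derivX derivC.
  rewrite addr0 mul1r => /eqP.
  have -> : - ('X * ('X + 1) ^+ n) + 2 * ('X + 1) * (('X + 1) ^+ n.-1 *+ n) =
     (-1) *: ('X + 1) ^+ n.+1 + (2 * n%:R + 1) *: ('X + 1) ^+ n :> {poly R}.
    rewrite -!mul_polyC !polyCD polyCN polyCM !polyC_natr -mulr_natr.
    by case: n => [|n]/=; rewrite ?exprS; ring.
  by rewrite lamP lamZ mulN1r addrC subr_eq0 => /eqP.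
have mN0 n : m n != 0.
  elim: n => [|n IH]; first by rewrite /m expr0.
  by rewrite mS mulf_neq0// -natrM natr1 pnatr_eq0.
have [L [p [C SE]]] := gen_normal_form S.
exists L => //; rewrite SE; apply/esym.
suff -> : (p%:P + map_poly polyC C : {poly {poly R}}) = 0 by rewrite addr0.
(* The coefficients of [a] are those of p expanded in powers of y + 1. *)
pose a := p \Po ('X - 1).
have pE : p = a \Po ('X + 1).
  rewrite /a -comp_polyA comp_polyB comp_polyX comp_polyC addrK.
  by rewrite comp_polyXr.
have lam_shift q n :
    lam ((q \Po ('X + 1)) * ('X + 1) ^+ n) = \sum_(k < size q) q`_k * m (n + k)%N.
  rewrite comp_polyE mulr_suml lam_sum; apply: eq_bigr => k _.
  by rewrite -scalerAl lamZ -exprD addnC.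
(* Test S on (y + 1)^n. For t > n the truncated difference n - t is harmless, since the falling
   factorial is then 0. *)
have key n : \sum_(k < size a) a`_k * m (n + k)%N +
    \sum_(t < size C) C`_t * (n ^_ t)%:R * m (n - t)%N = 0.
  have := lamS (('X + 1) ^+ n).
  rewrite SE wpactD wpact_weylM lamD lamG add0r wpactD wpactC lamD => e.
  rewrite -[RHS]e.
  congr (_ + _).
    by rewrite pE lam_shift.
  rewrite (@wpact_wide _ (size C)) ?size_poly// lam_sum; apply: eq_bigr => t _.
  rewrite coef_map/= derivn_Xadd1 mul_polyC lamZ -mulrA.
  by rewrite -[X in lam X]scaler_nat lamZ.
(* [A], [B 0] and [F] interpolate [m (n + k) / m n], [m n / m (n - t)] and
   [n ^_ t] as polynomials in [n]. *)
pose A k : {poly R} := \prod_(i < k) (2 *: 'X + (2 * i%:R + 1)%:P).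
pose B s T : {poly R} := \prod_(s <= i < T) (2 *: 'X - (2 * i%:R + 1)%:P).
pose F t : {poly R} := \prod_(i < t) ('X - i%:R%:P).
have Am n k : (A k).[n%:R] * m n = m (n + k)%N.
  elim: k => [|k IH]; first by rewrite /A big_ord0 hornerC mul1r addn0.
  rewrite /A big_ord_recr/= -/(A k) hornerM mulrAC IH addnS mS.
  rewrite !(hornerD, hornerN, hornerZ, hornerX, hornerC).
  rewrite natrD. ring.
have Bm n t : (t <= n)%N -> (B 0%N t).[n%:R] * m (n - t)%N = m n.
  elim: t => [|t IH] tn; first by rewrite /B big_nil hornerC mul1r subn0.
  rewrite -(IH (ltnW tn)) /B big_nat_recr//= -/(B 0%N t) hornerM -mulrA.
  congr (_ * _); rewrite -(subnSK tn) mS.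
  by rewrite !(hornerD, hornerN, hornerZ, hornerX, hornerC) natrB// -natr1; ring.
have Fn n t : (F t).[n%:R] = (n ^_ t)%:R.
  elim: t => [|t IH]; first by rewrite /F big_ord0 hornerC ffactn0.
  rewrite /F big_ord_recr/= -/(F t) hornerM IH ffactnSr natrM.
  rewrite !(hornerD, hornerN, hornerZ, hornerX, hornerC).
  have [tn|nt] := leqP t n; first by rewrite natrB.
  by rewrite ffact_small// !mul0r.
have Cconst : (size C <= 1)%N.
  rewrite leqNgt; apply/negP => C1.
  pose T := (size C).-1; have T0 : (0 < T)%N by rewrite /T; case: (size C) C1 => [|[]].
  have sC : size C = T.+1 by rewrite prednK// ltnW.
  (* This is [key] divided by [m n] and multiplied by the common denominator [B 0 T]; the quotient
     of [B 0 T] by [B 0 t] is [B t T]. *)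
  pose Q := (\sum_(k < size a) a`_k *: A k) * B 0%N T +
    \sum_(t < T.+1) C`_t *: (F t * B t T).
  have Q0 : Q = 0.
    apply: poly_nat_roots_eq0 => n; apply: (mulIf (mN0 n)); rewrite mul0r.
    rewrite -(mulr0 (B 0%N T).[n%:R]) -(key n) sC mulrDr /Q hornerD mulrDl.
    congr (_ + _).
      rewrite hornerM mulrAC mulrC; congr (_ * _).
      rewrite horner_sum mulr_suml; apply: eq_bigr => k _.
      by rewrite hornerZ -mulrA Am.
    rewrite horner_sum mulr_suml mulr_sumr; apply: eq_bigr => t _.
    rewrite hornerZ hornerM Fn.
    have [tn|nt] := leqP t n; last by rewrite ffact_small// !(mul0r,mulr0).
    have -> : B 0%N T = B 0%N t * B t T.
      by rewrite /B -big_cat_nat// -ltnS ltn_ord.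
    rewrite hornerM -(Bm n t tn); ring.
  (* At this point the factor of index T - 1 kills every [B t T] with t < T, including [B 0 T]
     because T > 0. Only the leading coefficient of [C] times [F T] survives. *)
  have := congr1 (horner ^~ (T%:R - 2^-1)) Q0.
  have B0 t : (t < T)%N -> (B t T).[T%:R - 2^-1] = 0.
    rewrite /B; case: (T) => // T' tT.
    rewrite big_nat_recr//= hornerM !(hornerD, hornerN, hornerZ, hornerX, hornerC).
    by rewrite [X in _ * X](_ : _ = 0) ?mulr0// -[T'.+1%:R]natr1; lra.
  rewrite /Q hornerD hornerM B0// mulr0 add0r big_ord_recr/= hornerD.
  rewrite horner_sum big1 ?add0r => [|t _]; last first.
    by rewrite hornerZ hornerM B0 ?mulr0.
  rewrite hornerZ hornerM /B big_geq// hornerC mulr1 horner0 => /eqP.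
  rewrite mulf_eq0 -[C`_T]/(lead_coef C) lead_coef_eq0 -size_poly_eq0 sC/=.
  rewrite horner_prod => /prodf_eq0[i _].
  rewrite !(hornerD, hornerN, hornerZ, hornerX, hornerC).
  (* A vanishing factor of [F T] would give T - 1/2 = i, which parity excludes. *)
  move=> /eqP Ti; have : (2 * (T - i))%:R = 1 :> R.
    rewrite natrM natrB; [move: Ti; lra | exact: ltnW (ltn_ord i)].
  by move/eqP; rewrite pnatr_eq1 => /eqP/(congr1 odd); rewrite oddM.
(* What is left of S modulo the ideal is multiplication by a polynomial, and [b] is that polynomial
   expanded in powers of y + 1. *)
pose b := a + (C`_0)%:P.
have bE : (p%:P + map_poly polyC C : {poly {poly R}}) = (b \Po ('X + 1))%:P.
  rewrite [in LHS](size1_polyC Cconst) map_polyC/= -polyCD pE.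
  by rewrite comp_polyD comp_polyC.
rewrite bE; suff -> : b = 0 by rewrite comp_poly0.
have Q0 : \sum_(k < size b) b`_k *: A k = 0.
  apply: poly_nat_roots_eq0 => n; apply: (mulIf (mN0 n)); rewrite mul0r.
  have := lamS (('X + 1) ^+ n).
  rewrite SE wpactD wpact_weylM lamD lamG add0r bE wpactC lam_shift => e.
  rewrite -[RHS]e.
  rewrite horner_sum mulr_suml; apply: eq_bigr => k _.
  by rewrite hornerZ -mulrA Am.
apply/polyP => k; rewrite coef0; elim/ltn_ind: k => k IH.
have [kb|/leq_sizeP->//] := ltnP k (size b).
(* The factor of index k of [A i] vanishes here for each i > k, while the terms with i < k are 0 by
   induction; the factors of [A k] are 2 (i - k) with i < k, hence nonzero. *)
have := congr1 (horner ^~ (- k%:R - 2^-1)) Q0.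
rewrite horner_sum (bigD1 (Ordinal kb))//= big1 ?addr0 => [|i].
  rewrite hornerZ horner0 => /eqP; rewrite mulf_eq0 => /orP[/eqP//|].
  rewrite horner_prod => /prodf_eq0[i _].
  rewrite !(hornerD, hornerN, hornerZ, hornerX, hornerC) => /eqP ki.
  have : (k%:R : R) = i%:R by lra.
  by move/eqP; rewrite eqr_nat => /eqP ki'; have := ltn_ord i; rewrite -ki' ltnn.
rewrite -val_eqE/= neq_ltn => /orP[ik|ki]; first by rewrite IH// scale0r horner0.
rewrite hornerZ horner_prod (bigD1 (Ordinal ki))//=.
rewrite !(hornerD, hornerN, hornerZ, hornerX, hornerC).
by rewrite [X in _ * (X * _)](_ : _ = 0) ?(mul0r,mulr0)//; lra.
Qed.
End annihilator.

(** * Integration against the normal law *)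

Section normal_density.
Context {R : realType}.
Variables (m s : R).
Local Notation mu := (@lebesgue_measure R).
Local Open Scope ereal_scope.

(** Both functions have the same integral over every measurable set, namely its normal
    probability. *)
Lemma ae_eq_normal_pdf :
  ae_eq mu setT (Radon_Nikodym_SigmaFinite.f (normal_prob m s) mu)
    (EFin \o normal_pdf m s).
Proof.
have dom := normal_prob_dominates m s.
apply: integral_ae_eq => //.
- exact: Radon_Nikodym_SigmaFinite.f_integrable.
- by apply/measurable_EFinP; exact: measurable_normal_pdf.
- by move=> E _ mE; rewrite -Radon_Nikodym_SigmaFinite.f_integral.
Qed.

Lemma ge0_integral_normal_prob (f : R -> \bar R) :
  measurable_fun setT f -> (forall x, 0 <= f x) ->
  \int[normal_prob m s]_x f x = \int[mu]_x (f x * (normal_pdf m s x)%:E).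
Proof.
move=> mf f0; have dom := normal_prob_dominates m s.
rewrite -(Radon_Nikodym_SigmaFinite.change_of_variables dom)//.
apply: ae_eq_integral => //.
- apply: emeasurable_funM => //; apply: (measurable_int mu).
  exact: Radon_Nikodym_SigmaFinite.f_integrable.
- apply: emeasurable_funM => //.
  by apply/measurable_EFinP; exact: measurable_normal_pdf.
- by apply: ae_eqe_mul2l; exact: ae_eq_normal_pdf.
Qed.

Lemma integral_normal_prob (f : R -> \bar R) :
  (normal_prob m s).-integrable setT f ->
  \int[normal_prob m s]_x f x = \int[mu]_x (f x * (normal_pdf m s x)%:E).
Proof.
move=> intf; have dom := normal_prob_dominates m s.
have mf := measurable_int _ intf.
rewrite -(Radon_Nikodym_change_of_variables dom)//.
apply: ae_eq_integral => //.
- exact: emeasurable_funM.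
- apply: emeasurable_funM => //.
  by apply/measurable_EFinP; exact: measurable_normal_pdf.
- apply: ae_eqe_mul2l; apply: (ae_eq_trans _ ae_eq_normal_pdf).
  exact/ae_eq_sym/ae_eq_Radon_Nikodym_SigmaFinite.
Qed.

End normal_density.

Section normal_rv.
Context {R : realType} d (T : measurableType d) (P : probability T R).
Variables (m s : R) (N : {RV P >-> R}).
Hypothesis N_normal : forall A : set R, measurable A ->
  distribution P N A = normal_prob m s A.
(* [measurableTypeR R] and [R] carry the same measurable sets, but different
   displays. *)
Let NR : T -> measurableTypeR R := N.
Let mNR : measurable_fun setT NR := measurable_funP N.
Let NR_mixin := isMeasurableFun.Build _ _ _ _ _ mNR.
Let NR_pack : {mfun T >-> measurableTypeR R} := HB.pack NR NR_mixin.
Local Notation mu := (@lebesgue_measure R).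

Lemma integrable_normal_rv (f : R -> R) : measurable_fun setT f ->
  P.-integrable setT (fun w => (f (N w))%:E) <->
  mu.-integrable setT (fun x => (f x * normal_pdf m s x)%:E).
Proof.
move=> mf.
(* Integrability is compared through absolute values, to which the change of variables for
   nonnegative functions applies. *)
have E : (\int[P]_w `|(f (N w))%:E| =
          \int[mu]_x `|(f x * normal_pdf m s x)%:E|)%E.
  transitivity (\int[distribution P NR_pack]_x `|(f x)%:E|)%E.
    rewrite ge0_integral_distribution//.
    by apply: measurableT_comp => //; exact/measurable_EFinP.
  transitivity (\int[normal_prob m s]_x `|(f x)%:E|)%E.
    by apply: eq_measure_integral => A mA _; exact: N_normal.
  rewrite ge0_integral_normal_prob//; last first.
    by apply: measurableT_comp => //; exact/measurable_EFinP.
  apply: eq_integral => x _.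
  by rewrite EFinM abseM (@gee0_abs _ (normal_pdf m s x)%:E)// lee_fin normal_pdf_ge0.
have m1 : measurable_fun setT (fun w => (f (N w))%:E).
  by apply/measurable_EFinP; apply: measurableT_comp.
have m2 : measurable_fun setT (fun x => (f x * normal_pdf m s x)%:E).
  apply/measurable_EFinP; apply: measurable_funM => //.
  exact: measurable_normal_pdf.
by split => /integrableP[_ h]; apply/integrableP; split => //; rewrite ?E// -E.
Qed.

Lemma expectation_normal_rv (f : R -> R) : measurable_fun setT f ->
  P.-integrable setT (fun w => (f (N w))%:E) ->
  ('E_P[fun w => f (N w)] = \int[mu]_x (f x * normal_pdf m s x)%:E)%E.
Proof.
move=> mf intf; rewrite unlock.
have mEf : measurable_fun setT (EFin \o f) by exact/measurable_EFinP.
transitivity (\int[distribution P NR_pack]_x (f x)%:E)%E.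
  by apply/esym/(@integral_distribution _ _ _ _ _ _ NR_pack).
transitivity (\int[normal_prob m s]_x (f x)%:E)%E.
  by apply: eq_measure_integral => A mA _; exact: N_normal.
rewrite integral_normal_prob//.
apply/integrableP; split => //.
rewrite (_ : (\int[normal_prob m s]_x _)%E = (\int[distribution P NR_pack]_x `|(f x)%:E|)%E).
  rewrite ge0_integral_distribution//; last exact: measurableT_comp.
  by case/integrableP : intf.
by apply: eq_measure_integral => A mA _; exact/esym/N_normal.
Qed.

End normal_rv.

(** * Polynomial growth against the Gaussian density *)

Section poly_growth.
Context {R : realType}.

(** With e = c / (k + 1), one has 1 + u <= (1 + 1/e) (1 + e u) <= (1 + 1/e) exp(e u); raise this to
    the power k + 1. The successor avoids a division by 0 at k = 0. *)
Lemma expR_dominates_pow (k : nat) (c : R) : 0 < c ->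
  exists2 C, 0 <= C & forall u, 0 <= u -> (1 + u) ^+ k <= C * expR (c * u).
Proof.
move=> c0; pose e := c / k.+1%:R.
have e0 : 0 < e by rewrite divr_gt0// ltr0n.
exists ((1 + e^-1) ^+ k.+1).
  by rewrite exprn_ge0// addr_ge0// invr_ge0 ltW.
move=> u u0; apply: (@le_trans _ _ ((1 + u) ^+ k.+1)).
  by rewrite exprS ler_peMl ?exprn_ge0 ?addr_ge0// lerDl.
have -> : expR (c * u) = expR (e * u) ^+ k.+1.
  rewrite -expRM_natl /e; congr expR; field.
  by rewrite nat1r pnatr_eq0.
rewrite -exprMn; apply: lerXn2r; rewrite ?nnegrE ?addr_ge0//.
  by rewrite mulr_ge0 ?expR_ge0// addr_ge0// invr_ge0 ltW.
apply: (@le_trans _ _ ((1 + e^-1) * (1 + e * u))).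
  have -> : (1 + e^-1) * (1 + e * u) = 1 + u + (e^-1 + e * u).
    by field; rewrite gt_eqF.
  by rewrite lerDl addr_ge0// ?mulr_ge0 ?invr_ge0// ltW.
by rewrite ler_wpM2l ?expR_ge1Dx// addr_ge0// invr_ge0 ltW.
Qed.

(** The weight 1 + x^2 dominates both 1 and |x|, so one power of it bounds all monomials at once. *)
Lemma poly_growth (p : {poly R}) :
  exists2 C, 0 <= C & forall x, `|p.[x]| <= C * (1 + x ^+ 2) ^+ size p.
Proof.
exists (\sum_(i < size p) `|p`_i|); first exact: sumr_ge0.
move=> x; rewrite horner_coef (le_trans (ler_norm_sum _ _ _))// mulr_suml.
apply: ler_sum => i _; rewrite normrM ler_wpM2l// normrX.
have x1 : 1 <= 1 + x ^+ 2 by rewrite lerDl sqr_ge0.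
apply: (@le_trans _ _ ((1 + x ^+ 2) ^+ i)); last first.
  by rewrite ler_weXn2l// ltnW.
apply: lerXn2r; rewrite ?nnegrE//; first exact: le_trans x1.
rewrite -(real_normK (num_real x)); have := normr_ge0 x.
by move: `|x| => t t0; have := sqr_ge0 (t - 1); nra.
Qed.

(** Half of the Gaussian exponent absorbs the polynomial factor: (1 + x^2)^k <= D exp(x^2 / 4), and
    what remains, exp(- x^2 / 4), is a multiple of the normal density of variance 2. This explains
    [s], and [K] adjusts the normalizing constants. *)
Lemma integrable_poly_growth_normal (f : R -> R) (C : R) (k : nat) :
  measurable_fun setT f -> (forall x, `|f x| <= C * (1 + x ^+ 2) ^+ k) ->
  (@lebesgue_measure R).-integrable setT
    (fun x => (f x * normal_pdf 0 1 x)%:E).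
Proof.
move=> mf fC.
have [D D0 hD] := @expR_dominates_pow k (4^-1) ltac:(by rewrite invr_gt0).
have C0 : 0 <= C.
  by have := fC 0; rewrite expr0n/= addr0 expr1n mulr1; apply: le_trans.
pose s : R := Num.sqrt 2.
have s2 : s ^+ 2 = 2 by rewrite sqr_sqrtr.
have s0 : s != 0 by rewrite gt_eqF// sqrtr_gt0.
pose K := C * D * normal_peak 1 / normal_peak s.
have := @integrableZl _ _ _ (@lebesgue_measure R) setT measurableT K
   _ (integrable_normal_pdf 0 s).
apply: le_integrable => //.
  apply/measurable_EFinP/measurable_funM => //.
  exact: measurable_normal_pdf.
move=> x _; rewrite -EFinM !abse_EFin lee_fin [leRHS]ger0_norm; last first.
  rewrite mulr_ge0 ?normal_pdf_ge0// /K divr_ge0 ?normal_peak_ge0//.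
  by rewrite !mulr_ge0 ?normal_peak_ge0.
rewrite normrM (ger0_norm (normal_pdf_ge0 _ _ _)).
rewrite !normal_pdfE ?oner_eq0// /normal_fun subr0 s2 expr1n.
have -> : K * (normal_peak s * expR (- x ^+ 2 / (2 *+ 2))) =
          normal_peak 1 * (C * (D * expR (- x ^+ 2 / (2 *+ 2)))).
  rewrite /K; field; exact/lt0r_neq0/normal_peak_gt0.
rewrite mulrCA ler_wpM2l ?normal_peak_ge0//.
apply: (@le_trans _ _ (C * (1 + x ^+ 2) ^+ k * expR (- x ^+ 2 / (1 *+ 2)))).
  by rewrite ler_wpM2r ?expR_ge0.
rewrite -mulrA ler_wpM2l//.
apply: (@le_trans _ _ (D * expR (4^-1 * x ^+ 2) * expR (- x ^+ 2 / (1 *+ 2)))).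
  by rewrite ler_wpM2r ?expR_ge0 ?hD ?sqr_ge0.
rewrite -mulrA -expRD ler_wpM2l// ler_expR; lra.
Qed.

End poly_growth.

(** * Integrals of derivatives of odd functions *)

Section odd_primitive.
Context {R : realType}.
Local Notation mu := (@lebesgue_measure R).

Lemma integrable_cvg_pinfty (F : R -> R) (l : R) :
  mu.-integrable setT (EFin \o F) -> F x @[x --> +oo] --> l -> l = 0.
Proof.
move=> iF Fl; apply/eqP; apply: contraT => l0.
have l2 : 0 < `|l| / 2 by rewrite divr_gt0 ?normr_gt0.
have [A [_ FA]] : \forall x \near +oo, `|l| / 2 <= `|F x|.
  near=> x.
  have h : `|l - F x| <= `|l| / 2.
    by near: x; move/cvgrPdist_le : Fl; apply.
  have := ler_distD (F x) l 0; rewrite !subr0; lra.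
have /integrableP[mF finF] := iF.
pose K := fine (\int[mu]_x `|(F x)%:E|).
have KE : (\int[mu]_x `|(F x)%:E| = K%:E)%E.
  by rewrite fineK// ge0_fin_numE// integral_ge0.
(* On an interval of this length beyond [A], the bound |l| / 2 <= |F| already contributes K + 1,
   more than the whole integral [K]. *)
pose M := (K + 1) / (`|l| / 2).
have K0 : 0 <= K by rewrite -lee_fin -KE integral_ge0.
have M0 : 0 < M by rewrite divr_gt0// ltr_wpDl.
have : (((`|l| / 2) * M)%:E <= K%:E)%E.
  have mAF : measurable_fun setT (fun x => `|(F x)%:E|%E) by exact: measurableT_comp.
  pose D : set R := [set` `]A, A + M]].
  have mD : measurable (D : set (measurableTypeR R)) by exact: measurable_itv.
  have le1 : (\int[mu]_(x in D) (`|l| / 2)%:E <= \int[mu]_(x in D) `|(F x)%:E|)%E.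
    apply: ge0_le_integral => //.
    - exact: measurable_funTS.
    - by move=> x; rewrite /D/= in_itv/= => /andP[Ax _]; rewrite lee_fin FA.
  have le2 : (\int[mu]_(x in D) `|(F x)%:E| <= \int[mu]_x `|(F x)%:E|)%E.
    exact: ge0_subset_integral.
  rewrite -KE; apply: le_trans le2; apply: le_trans le1.
  rewrite integral_cst//= lebesgue_measure_itv/= lte_fin ltrDl M0.
  by rewrite -EFinB addrAC subrr add0r.
rewrite lee_fin /M mulrC divfK ?gt_eqF//; lra.
Unshelve. all: by end_near. Qed.

(** The integral of f over [-u, u] is F(u) - F(-u) = 2 F(u) and tends to the full integral. So F has
    a limit at infinity, and integrability of F forces that limit to be 0. *)
Lemma integral_derive_odd (F f : R -> R) :
  (forall x : R, is_derive x (1 : R) F (f x)) -> continuous f ->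
  (forall x, F (- x) = - F x) ->
  mu.-integrable setT (EFin \o F) -> mu.-integrable setT (EFin \o f) ->
  (\int[mu]_x (f x)%:E = 0)%E.
Proof.
move=> dF cf oF iF if_.
have cF : continuous F.
  by move=> x; apply/differentiable_continuous/derivable1_diffP.
have := integrable_fin_num measurableT if_.
set I := (\int[mu]_x _)%E => Ifin.
suff : fine I / 2 = 0 by move=> h; rewrite -(fineK Ifin); congr EFin; lra.
apply: (integrable_cvg_pinfty iF).
apply/cvg_pinftyP => u uoo.
(* At each x these truncations are eventually equal to f x, and |f| dominates them. *)
pose g n x := ((f \_ `[- u n, u n]) x)%:E.
have gI : (\int[mu]_x g n x)%E @[n --> \oo] --> I.
  rewrite /I; apply: (@dominated_cvg _ _ _ mu setT _ _ _ (fun x => `|f x|%:E)) => //.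
  - move=> n; apply/measurable_EFinP/(measurable_restrictT f) => //.
    by apply: measurable_funTS; exact: continuous_measurable_fun.
  - move=> x _; apply: cvg_near_cst.
    near=> n; rewrite /g patchE ifT// inE/= in_itv/= -ler_norml.
    by near: n; move/cvgryPge : uoo; apply.
  - exact: (integrable_norm if_).
  - move=> n x _; rewrite abse_EFin lee_fin patchE.
    by case: ifP => // _; rewrite normr0.
have gE : \forall n \near \oo, (\int[mu]_x g n x)%E = (2 * F (u n))%:E.
  near=> n.
  have un : 0 < u n by near: n; move/cvgryPgt : uoo; apply.
  have unN : - u n < u n by rewrite (@lt_trans _ _ 0)// oppr_lt0.
  transitivity (\int[mu]_(x in `[(- u n)%R, u n]) (f x)%:E)%E.
    rewrite [RHS]integral_mkcond; apply: eq_integral => x _.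
    by rewrite /g !patchE; case: ifP.
  rewrite (continuous_FTC2 unN (F := F)).
  - by rewrite oF -EFinB opprK; congr EFin; lra.
  - exact: continuous_subspaceT.
  - split; first by move=> x _; exact: ex_derive.
    + exact/cvg_at_right_filter/cF.
    + exact/cvg_at_left_filter/cF.
  - by move=> x _; rewrite derive1E; exact: derive_val.
have fI : (fine (\int[mu]_x g n x)%E) @[n --> \oo] --> fine I.
  by apply: fine_cvg; rewrite fineK.
have {}fI : 2 * F (u n) @[n --> \oo] --> fine I.
  apply: cvg_trans fI; apply: near_eq_cvg; near=> n.
  by rewrite (near gE n).
have -> : (fun n => F (u n)) = (fun n => 2 * F (u n) / 2).
  by apply/funext => n /=; rewrite mulrAC divff ?mul1r.
exact: cvgMr_tmp.
Unshelve. all: by end_near. Qed.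

End odd_primitive.

(** * The Stein identity for right multiples of [G] *)

Section weyl_apply.
Context {R : realType}.
Implicit Types (S L M : weyl R) (df : nat -> R -> R).
Local Notation G := (chi2_gen R).

Lemma weyl_apply_wide n S df y : (size S <= n)%N ->
  weyl_apply S df y = \sum_(t < n) (S`_t).[y] * df t y.
Proof.
move=> Sn; rewrite /weyl_apply.
rewrite (big_ord_widen _ (fun t => (S`_t).[y] * df t y) Sn) big_mkcond.
apply: eq_bigr => t _; case: ltnP => // St.
by rewrite nth_default// horner0 mul0r.
Qed.

Lemma weyl_applyD (S L : {poly {poly R}}) df y :
  weyl_apply (S + L) df y = weyl_apply S df y + weyl_apply L df y.
Proof.
pose n := maxn (size S) (size L).
rewrite (@weyl_apply_wide n (S + L)) ?size_polyD//.
rewrite (@weyl_apply_wide n S) ?leq_maxl// (@weyl_apply_wide n L) ?leq_maxr//.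
by rewrite -big_split; apply: eq_bigr => t _; rewrite coefD hornerD mulrDl.
Qed.

Lemma weyl_applyZ p (S : {poly {poly R}}) df y :
  weyl_apply (p *: S) df y = p.[y] * weyl_apply S df y.
Proof.
rewrite (@weyl_apply_wide (size S) (p *: S)) ?size_scale_leq// mulr_sumr.
by apply: eq_bigr => t _; rewrite coefZ hornerM mulrA.
Qed.

Lemma weyl_apply_wdcomp (S : {poly {poly R}}) df y :
  weyl_apply (wdcomp S) df y =
  \sum_(t < size S) ((S`_t)^`().[y] * df t y + (S`_t).[y] * df t.+1 y).
Proof.
have sX : (size (S * 'X)%R <= (size S).+1)%N.
  by rewrite (leq_trans (size_polyMleq _ _))// size_polyX addn2.
rewrite weyl_applyD (@weyl_apply_wide (size S).+1)// big_ord_recl coefMX/=.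
rewrite horner0 mul0r add0r (@weyl_apply_wide (size S) (map_poly _ _)); last first.
  by rewrite (leq_trans (size_poly _ _)).
rewrite -big_split; apply: eq_bigr => t _ /=.
by rewrite coefMX/= coef_map/= addrC.
Qed.

Lemma weyl_apply_gen L df y : weyl_apply (G * L) df y =
  - y * weyl_apply L df y + 2 * (y + 1) * weyl_apply (wdcomp L) df y.
Proof.
rewrite gen_mulE -scaleNr weyl_applyD !weyl_applyZ; congr (_ * _ + _ * _).
  by rewrite hornerN hornerX.
by rewrite -(polyC_natr R 2) hornerM hornerC hornerD hornerX hornerC.
Qed.

Lemma is_derive_weyl_apply L df (y : R) :
  (forall t, (t < size L)%N -> is_derive y (1 : R) (df t) (df t.+1 y)) ->
  is_derive y (1 : R) (weyl_apply L df) (weyl_apply (wdcomp L) df y).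
Proof.
move=> dfE; rewrite weyl_apply_wdcomp.
have -> : weyl_apply L df = \sum_(t < size L) (horner L`_t * df t).
  by apply/funext => z; rewrite /weyl_apply fct_sumE.
apply: is_derive_sum => t.
have dt := dfE _ (ltn_ord t).
apply: is_derive_eq.
by rewrite addrC /GRing.scale/= [df t y * _]mulrC.
Qed.

(** The inner function will be x^2 - 1: for the operator-dependent class, [df t] is continuous only
    relative to the half-line where x^2 - 1 takes its values. *)
Lemma continuous_weyl_apply (phi : R -> R) n L df : (size L <= n)%N ->
  continuous phi ->
  (forall t, (t < n)%N -> continuous (df t \o phi)) ->
  continuous (weyl_apply L df \o phi).
Proof.
move=> Ln cphi cdf x.
have -> : weyl_apply L df \o phi = fun x => \sum_(t < n) (L`_t).[phi x] * df t (phi x).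
  by apply/funext => z /=; exact: weyl_apply_wide.
elim: n {Ln} cdf => [|n IH] cdf.
  rewrite (_ : (fun _ => _) = cst 0); first exact: cst_continuous.
  by apply/funext => z; rewrite big_ord0.
  rewrite (_ : (fun _ => _) = (fun z => \sum_(t < n) (L`_t).[phi z] * df t (phi z) +
    (L`_n).[phi z] * df n (phi z))); last first.
    by apply/funext => z; rewrite big_ord_recr.
apply: cvgD; first by apply: IH => t tn; apply: cdf; rewrite ltnW.
apply: cvgM; last exact: cdf.
apply: (continuous_comp (f := phi)); first exact: cphi.
exact: continuous_horner.
Qed.

(** Expansion into the monomials y^j d^t, whose integrability is what the operator-dependent class
    provides. *)
Lemma integrable_weyl_apply d (T : measurableType d) (P : probability T R)
    (Y : T -> R) n D (L : {poly {poly R}}) df :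
  (size L <= n)%N -> (forall t, (size (L`_t)%R <= D.+1)%N) ->
  (forall j t, (j <= D)%N -> (t < n)%N ->
    P.-integrable setT (fun w => (Y w ^+ j * df t (Y w))%:E)) ->
  P.-integrable setT (fun w => (weyl_apply L df (Y w))%:E).
Proof.
move=> Ln LD iY.
have -> : (fun w => (weyl_apply L df (Y w))%:E) =
  (fun w => \sum_(t < n) \sum_(j < D.+1)
     (L`_t`_j)%:E * (Y w ^+ j * df t (Y w))%:E)%E.
  apply/funext => w; rewrite (weyl_apply_wide _ _ Ln).
  rewrite -sumEFin; apply: eq_bigr => t _.
  rewrite (horner_coef_wide _ (LD t)) mulr_suml -sumEFin.
  by apply: eq_bigr => j _; rewrite -EFinM mulrA.
apply: integrable_sum => // t _; apply: integrable_sum => // j _.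
by apply: integrableZl => //; apply: iY => //; rewrite -ltnS.
Qed.

Let two_X1_neq0 : 2 * ('X + 1) != 0 :> {poly R}.
Proof.
rewrite mulf_neq0//; first by rewrite -(polyC_natr R 2) polyC_eq0 pnatr_eq0.
by rewrite -polyC1 -size_poly_eq0 size_XaddC.
Qed.

Lemma coef_gen_mulS L t : (G * L : {poly {poly R}})`_t.+1 =
  - ('X * L`_t.+1) + 2 * ('X + 1) * (L`_t + deriv L`_t.+1).
Proof. by rewrite gen_mulE coefD coefN !coefZ coefD coefMX coef_map. Qed.

(** The top coefficient of [L], multiplied by 2 (y + 1), appears in [G * L] one order higher. Hence
    the regularity granted for [G * L] allows [L] f to be differentiated once. *)
Lemma size_gen_mul L : (size L <= (size (G * L)%R).-1)%N.
Proof.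
case sL : (size L) => [//|n].
suff : (G * L : {poly {poly R}})`_n.+1 != 0.
  move=> h; rewrite -ltnS (@leq_trans (size (G * L)%R))// ?leqSpred//.
  by rewrite ltnNge; apply: contra h => h; rewrite nth_default.
rewrite coef_gen_mulS [L`_n.+1]nth_default ?sL// deriv0 mulr0 oppr0 add0r addr0.
rewrite mulf_neq0 ?two_X1_neq0// -[n]/(n.+1.-1) -sL -[_`_ _]/(lead_coef _).
by rewrite lead_coef_eq0 -size_poly_eq0 sL.
Qed.

Lemma size_coef_degree (S : weyl R) t :
  (size ((S : {poly {poly R}})`_t)%R <= (coef_degree S).+1)%N.
Proof.
have [tS|St] := ltnP t (size S); last by rewrite nth_default// size_poly0.
apply: leq_trans (leqSpred _) _; rewrite ltnS.
exact: (leq_bigmax (Ordinal tS)).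
Qed.

(* The coefficient of [d^t.+1] in [G * L] is [2 (y + 1) L_t] up to terms that
   only involve [L_t.+1]; hence the downward induction on [t]. *)
Lemma size_coef_gen_mul L t : (size (L`_t)%R <= coef_degree (G * L)%R)%N.
Proof.
set D := coef_degree _.
have [k] : exists k, (size L <= t + k)%N by exists (size L); rewrite leq_addl.
elim: k t => [|k IH] t; first by rewrite addn0 => Lt; rewrite nth_default// size_poly0.
rewrite -addSnnS => /IH {}IH.
have [->|Lt0] := eqVneq L`_t 0; first by rewrite size_poly0.
have LtE : 2 * ('X + 1) * L`_t = (G * L : {poly {poly R}})`_t.+1 +
    'X * L`_t.+1 - 2 * ('X + 1) * deriv L`_t.+1.
  by rewrite coef_gen_mulS; ring.
have s2 (p : {poly R}) : size (2 * ('X + 1) * p)%R = size ('X * p)%R.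
  have [->|p0] := eqVneq p 0; first by rewrite !mulr0.
  rewrite -mulrA -(polyC_natr R 2) size_Cmul ?pnatr_eq0// -polyC1.
  by rewrite !size_mul ?polyX_eq0// -?size_poly_eq0 size_XaddC ?size_polyX.
have sX (p : {poly R}) : p != 0 -> size ('X * p)%R = (size p).+1.
  by move=> p0; rewrite mulrC size_mulX.
have sXle (p : {poly R}) m : (size p <= m)%N -> (size ('X * p)%R <= m.+1)%N.
  have [->|p0 pm] := eqVneq p 0; first by rewrite mulr0 size_poly0.
  by rewrite sX// ltnS.
rewrite -ltnS -sX// -s2 LtE (leq_trans (size_polyD _ _))// geq_max size_polyN s2.
rewrite (leq_trans (size_polyD _ _)) ?geq_max ?size_coef_degree ?sXle//.
by rewrite (leq_trans (size_poly _ _))// (leq_trans (leq_pred _)).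
Qed.

End weyl_apply.

Section stein_core.
Context {R : realType}.
Local Notation G := (chi2_gen R).
Local Notation mu := (@lebesgue_measure R).
Local Notation phi := (@normal_pdf R 0 1).

Lemma is_derive_cvg (f : R -> R) (x l : R) :
  h^-1 * (f (h + x) - f x) @[h --> 0^'] --> l -> is_derive x (1 : R) f l.
Proof.
move=> fl.
have fl' : h^-1 *: ((f \o shift x) (h *: (1 : R)) - f x) @[h --> 0^'] --> l.
  rewrite (_ : (fun _ => _) = (fun h => h^-1 * (f (h + x) - f x)))//.
  by apply/funext => h /=; rewrite /GRing.scale/= mulr1.
by apply: DeriveDef; [exact: cvgP fl' | exact: cvg_lim fl'].
Qed.

Lemma is_derive_normal_pdf (x : R) : is_derive x (1 : R) phi (- x * phi x).
Proof.
rewrite normal_pdfE ?oner_eq0// /normal_fun.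
under eq_fun do rewrite subr0 expr1n.
have -> : (fun y : R => normal_peak 1 * expR (- y ^+ 2 / (1 *+ 2))) =
   normal_peak 1 \*: (expR \o horner (- (2^-1) *: 'X^2)).
  apply/funext => y; rewrite /= hornerZ hornerXn /GRing.scale/=.
  by congr (_ * expR _); lra.
have dq : is_derive x (1 : R) (horner (- (2^-1) *: 'X^2)) (- x).
  by apply: is_derive_eq; rewrite derivZ derivXn hornerZ hornerMn hornerXn expr1; lra.
apply: is_derive_eq.
rewrite subr0 expr1n.
have -> : - x ^+ 2 / (1 *+ 2) = (- (2^-1) *: 'X^2).[x].
  by rewrite hornerZ hornerXn; lra.
by rewrite /GRing.scale/=; ring.
Qed.

Lemma normal_pdf_even (x : R) : phi (- x) = phi x.
Proof. by rewrite normal_pdfE ?oner_eq0// /normal_fun !subr0 sqrrN. Qed.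

(* At [0] the factor [x] turns the mere continuity of [h] into
   differentiability, so nothing is required of [h] at [-1]. *)
Lemma is_derive_id_sqrB1 (h h1 : R -> R) (x : R) :
  (forall y : R, -1 < y -> is_derive y (1 : R) h (h1 y)) ->
  continuous (fun x : R => h (x ^+ 2 - 1)) ->
  is_derive x (1 : R) (fun x : R => x * h (x ^+ 2 - 1))
    (h (x ^+ 2 - 1) + 2 * x ^+ 2 * h1 (x ^+ 2 - 1)).
Proof.
move=> dh ch; have [->|x0] := eqVneq x 0.
  rewrite expr0n/= mulr0 mul0r addr0.
  apply: is_derive_cvg.
  have /continuous_withinNx c0 := ch 0.
  apply: (@cvg_trans _ (h (y ^+ 2 - 1) @[y --> (0 : R)^'])).
    apply: near_eq_cvg; near=> y.
    rewrite addr0 mul0r subr0 mulKf//.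
    by near: y; exact: nbhs_dnbhs_neq.
  by move: c0; rewrite expr0n.
have y1 : -1 < x ^+ 2 - 1 by rewrite ltrBrDr addNr exprn_even_gt0.
have dy := dh _ y1.
have -> : (fun x : R => x * h (x ^+ 2 - 1)) = (id : R -> R) * (h \o horner ('X^2 - 1)).
  by apply/funext => z; rewrite fctE/= !hornerE.
have dp : is_derive x (1 : R) (horner ('X^2 - 1)) (2 * x).
  apply: is_derive_eq; rewrite derivB derivXn derivC subr0 hornerMn !hornerE.
  by rewrite mulr_natl.
have dy' : is_derive ('X^2 - 1).[x] (1 : R) h (h1 (x ^+ 2 - 1)).
  by rewrite !hornerE.
have dc := @is_derive1_comp _ _ _ _ _ _ dy' dp.
apply: is_derive_eq.
rewrite /GRing.scale/= !(hornerD, hornerN, hornerXn, hornerC). ring.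
Unshelve. all: by end_near. Qed.

End stein_core.

Section stein_gen.
Context {R : realType} d (T : measurableType d) (P : probability T R).
Variables (N Y : {RV P >-> R}).
Hypothesis N_normal : forall A : set R, measurable A ->
  distribution P N A = normal_prob (0 : R) (1 : R) A.
Hypothesis Y_def : forall w, Y w = N w ^+ 2 - 1.
Local Notation G := (chi2_gen R).
Local Notation mu := (@lebesgue_measure R).
Local Notation phi := (@normal_pdf R 0 1).

(** Put h = L f. The function x h(x^2 - 1) phi(x) is an odd primitive of (G h)(x^2 - 1) phi(x), by
    phi' = - x phi, so [integral_derive_odd] applies. The hypotheses are weak enough to serve smooth
    functions and one-sided derivatives on the half-line alike. *)
Lemma stein_identity_gen (L : weyl R) (df : nat -> R -> R)
    (n := order_bound (G * L)) (D := coef_degree (G * L)) :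
  (forall t (y : R), (t < n)%N -> -1 < y ->
     is_derive y (1 : R) (df t) (df t.+1 y)) ->
  (forall t, (t <= n)%N -> continuous (fun x : R => df t (x ^+ 2 - 1))) ->
  (forall j t, (j <= D)%N -> (t <= n)%N ->
     P.-integrable setT (fun w => (Y w ^+ j * df t (Y w))%:E)) ->
  stein_identity Y (G * L) df.
Proof.
move=> dfE cdf idf.
have Ln : (size L <= n)%N.
  by rewrite (leq_trans (size_gen_mul L))// /n /order_bound leq_maxr.
have Sn : (size (G * L)%R <= n.+1)%N.
  by rewrite (leq_trans (leqSpred _))// ltnS /n /order_bound leq_maxr.
pose h := weyl_apply L df; pose h1 := weyl_apply (wdcomp L) df.
pose sq := horner ('X^2 - 1 : {poly R}).
have sqE x : sq x = x ^+ 2 - 1 by rewrite /sq !(hornerD, hornerN, hornerXn, hornerC).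
have csq : continuous sq by exact: continuous_horner.
have cdf' t : (t < n.+1)%N -> continuous (df t \o sq).
  by move=> tn; rewrite /comp; under eq_fun do rewrite sqE; exact: cdf.
have cS : continuous (fun x : R => weyl_apply (G * L) df (x ^+ 2 - 1)).
  have := @continuous_weyl_apply _ sq n.+1 (G * L) df Sn csq cdf'.
  by rewrite /comp; under eq_fun do rewrite sqE.
have ch : continuous (fun x : R => h (x ^+ 2 - 1)).
  have := @continuous_weyl_apply _ sq n.+1 L df (leqW Ln) csq cdf'.
  by rewrite /comp; under eq_fun do rewrite sqE.
have dh (y : R) : -1 < y -> is_derive y (1 : R) h (h1 y).
  move=> y1; apply: is_derive_weyl_apply => t tL.
  by apply: dfE => //; exact: leq_trans Ln.
have iS : P.-integrable setT (fun w => (weyl_apply (G * L) df (Y w))%:E).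
  apply: (@integrable_weyl_apply _ _ _ _ _ n.+1 D) => //.
  by move=> t; exact: size_coef_degree.
(* Since |x| <= x^2 + 1 = y + 2, this operator dominates the primitive [F] below. Its coefficients
   have degree at most [D] because those of [L] have degree less than [D] or vanish. *)
pose M : {poly {poly R}} := ('X + 2%:P) *: (L : {poly {poly R}}).
have iM : P.-integrable setT (fun w => (weyl_apply M df (Y w))%:E).
  apply: (@integrable_weyl_apply _ _ _ _ _ n.+1 D) => //.
    by rewrite (leq_trans (size_scale_leq _ _))// leqW.
  move=> t; rewrite coefZ.
  have [->|Lt0] := eqVneq (L : {poly {poly R}})`_t 0; first by rewrite mulr0 size_poly0.
  rewrite (leq_trans (size_polyMleq _ _))// size_XaddC/= ltnS.
  exact: size_coef_gen_mul.
split => //.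
have mS := continuous_measurable_fun cS.
pose S x := weyl_apply (G * L) df (x ^+ 2 - 1).
have SE : (fun w => weyl_apply (G * L) df (Y w)) = fun w => S (N w).
  by apply/funext => w; rewrite Y_def.
rewrite SE (expectation_normal_rv N_normal mS); last first.
  by move: iS; under eq_fun do rewrite Y_def.
pose F x := x * h (x ^+ 2 - 1) * phi x.
have cphi : continuous phi by apply: continuous_normal_pdf; exact: oner_neq0.
have cF : continuous F.
  move=> x; apply: cvgM; last exact: cphi.
  by apply: cvgM; [exact: cvg_id | exact: ch].
apply: (@integral_derive_odd _ F).
- move=> x.
  have d1 := @is_derive_id_sqrB1 R h h1 x dh ch.
  have d2 := is_derive_normal_pdf x.
  apply: is_derive_eq.
  rewrite /S weyl_apply_gen /GRing.scale/= -/h -/h1; ring.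
- by move=> x; apply: cvgM; [exact: cS | exact: cphi].
- by move=> x; rewrite /F normal_pdf_even sqrrN !mulNr.
- have : mu.-integrable setT
    (fun x => (weyl_apply M df (x ^+ 2 - 1) * phi x)%:E).
    apply/(integrable_normal_rv N_normal); last first.
      by move: iM; under eq_fun do rewrite Y_def.
    apply: continuous_measurable_fun => x.
    rewrite (_ : (fun _ => _) = fun x => ('X + 2%:P).[sq x] * h (x ^+ 2 - 1)).
      apply: cvgM; last exact: ch.
      apply: (@continuous_comp _ _ _ sq); first exact: csq.
      exact: continuous_horner.
    by apply/funext => z; rewrite weyl_applyZ sqE.
  apply: le_integrable => //.
    by apply/measurable_EFinP; exact: continuous_measurable_fun.
  move=> x _; rewrite /F /M weyl_applyZ !abse_EFin lee_fin !normrM.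
  rewrite ler_wpM2r// ler_wpM2r// hornerD hornerX hornerC.
  rewrite [leRHS]ger0_norm; last by have := sqr_ge0 x; lra.
  rewrite -(real_normK (num_real x)); have := sqr_ge0 (`|x| - 1); nra.
- apply/(integrable_normal_rv N_normal) => //.
  by move: iS; under eq_fun do rewrite Y_def.
Qed.

End stein_gen.

(** * Function classes *)

Section derivatives.
Context {R : realType}.

Lemma derive1n_horner (p : {poly R}) t : derive1n t (horner p) = horner (derivn t p).
Proof.
elim: t => [|t IH]; first by rewrite derive1n0.
by rewrite derive1nS IH derivnS derivE.
Qed.

Lemma smooth_horner (p : {poly R}) : smooth (horner p).
Proof. by move=> n x; rewrite derive1n_horner; exact: derivable_horner. Qed.

Lemma is_derive_smooth (f : R -> R) : smooth f -> forall t (x : R),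
  is_derive x (1 : R) (derive1n t f) (derive1n t.+1 f x).
Proof.
by move=> sf t x; rewrite derive1nS derive1E; exact/derivableP/sf.
Qed.

Lemma continuous_smooth (f : R -> R) : smooth f -> forall t, continuous (derive1n t f).
Proof.
by move=> sf t x; exact/differentiable_continuous/derivable1_diffP/sf.
Qed.

Lemma weyl_apply_horner (S : weyl R) (p : {poly R}) y :
  weyl_apply S (fun t => horner (derivn t p)) y = (wpact S p).[y].
Proof.
by rewrite /wpact horner_sum; apply: eq_bigr => t _; rewrite hornerM.
Qed.

Lemma schwartz_slow_growth : @schwartz R `<=` slow_growth.
Proof.
move=> f [sf bf]; split=> // b; exists 1 => //.
have [M fM] := bf 0%N b; exists M => x; apply: le_trans (fM x).
rewrite expr0 mul1r normrM ler_piMl// normfV ger0_norm ?addr_ge0 ?powR_ge0//.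
by rewrite invf_le1 ?lerDl ?powR_ge0// ltr_pwDl ?powR_ge0.
Qed.

Lemma polynomial_fun_slow_growth : @polynomial_fun R `<=` slow_growth.
Proof.
move=> _ [p ->]; split; first exact: smooth_horner.
move=> b; rewrite derive1n_horner; set q := derivn b p.
(* The successor keeps the exponent at least 1 even when [q] is 0. *)
pose n := (size q).+1; exists n%:R; first by rewrite ler1n.
exists (\sum_(i < size q) `|q`_i|) => x.
have w0 : 0 < 1 + `|x| `^ n%:R by rewrite ltr_pwDl ?powR_ge0.
rewrite normrM normfV (gtr0_norm w0) mulrC ler_pdivrMr// powR_mulrn//.
rewrite horner_coef (le_trans (ler_norm_sum _ _ _))// mulr_suml.
apply: ler_sum => i _; rewrite normrM ler_wpM2l// normrX.
have [x1|/ltW x1] := leP `|x| 1.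
  by rewrite (le_trans (exprn_ile1 _ _ x1))// lerDl exprn_ge0.
by rewrite (le_trans (ler_weXn2l x1 (ltnW (leqW (ltn_ord i)))))// lerDr.
Qed.

Lemma PSO_subset d (T : measurableType d) (P : probability T R) (Y : {RV P >-> R})
    (F1 F2 : set (R -> R)) : F1 `<=` F2 -> PSO Y F2 `<=` PSO Y F1.
Proof. by move=> F12 S h f /F12; exact: h. Qed.

End derivatives.

Section chi2_classes.
Context {R : realType} d (T : measurableType d) (P : probability T R).
Variables (N Y : {RV P >-> R}).
Hypothesis N_normal : forall A : set R, measurable A ->
  distribution P N A = normal_prob (0 : R) (1 : R) A.
Hypothesis Y_def : forall w, Y w = N w ^+ 2 - 1.
Local Notation G := (chi2_gen R).

(** At y = x^2 - 1 the weight 2 + y is 1 + x^2, so the bound becomes polynomial growth in the normal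
    variable. *)
Lemma integrable_growth_chi2 (f : R -> R) (C : R) (k : nat) :
  continuous f -> (forall y, -1 <= y -> `|f y| <= C * (2 + y) ^+ k) ->
  P.-integrable setT (fun w => (f (Y w))%:E).
Proof.
move=> cf fC; under eq_fun do rewrite Y_def.
have cf' : continuous (fun x : R => f (x ^+ 2 - 1)).
  have -> : (fun x : R => f (x ^+ 2 - 1)) = f \o horner ('X^2 - 1).
    by apply/funext => x; rewrite /= !(hornerD, hornerN, hornerXn, hornerC).
  move=> x; apply: continuous_comp; first exact: continuous_horner.
  exact: cf.
have mf := continuous_measurable_fun cf'.
apply/(integrable_normal_rv N_normal mf).
apply: (integrable_poly_growth_normal (C := C) (k := k) mf) => x.
apply: le_trans (fC _ _) _; first by have := sqr_ge0 x; lra.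
by rewrite (_ : 2 + (x ^+ 2 - 1) = 1 + x ^+ 2)//; ring.
Qed.

Lemma integrable_poly_chi2 (p : {poly R}) :
  P.-integrable setT (fun w => (p.[Y w])%:E).
Proof.
pose q := p \Po ('X^2 - 1).
have qE w : p.[Y w] = q.[N w].
  by rewrite Y_def horner_comp !(hornerD, hornerN, hornerXn, hornerC).
under eq_fun do rewrite qE.
have mq : measurable_fun setT (horner q).
  by apply: continuous_measurable_fun; exact: continuous_horner.
have [C _ hC] := poly_growth q.
by apply/(integrable_normal_rv N_normal mq)/(integrable_poly_growth_normal mq hC).
Qed.

Lemma right_ideal_PSO_slow_growth : right_ideal1 G `<=` PSO Y slow_growth.
Proof.
move=> _ [L _ <-] f [sf bf]; apply: (stein_identity_gen N_normal Y_def).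
- by move=> t y _ _; exact: is_derive_smooth.
- move=> t _.
  have -> : (fun x : R => derive1n t f (x ^+ 2 - 1)) =
     derive1n t f \o horner ('X^2 - 1).
    by apply/funext => x; rewrite /= !(hornerD, hornerN, hornerXn, hornerC).
  move=> x; apply: continuous_comp; first exact: continuous_horner.
  exact: continuous_smooth.
move=> j t _ _; have [a a1 [M fM]] := bf t.
(* A natural exponent above [a]. For y >= -1 one has |y| <= 2 + y and 1 <= 2 + y, hence 1 + |y|^a <=
   2 (2 + y)^k, which explains the constant [M * 2]. *)
pose k := Num.bound a.
have ak : a <= k%:R by rewrite ltW// archi_boundP// (le_trans ler01).
apply: (@integrable_growth_chi2 (fun y => y ^+ j * derive1n t f y) (M * 2) (j + k)).
  move=> y; apply: cvgM; last exact: continuous_smooth.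
  exact: exprn_continuous.
move=> y y1; rewrite normrM normrX exprD mulrCA.
have yle : `|y| <= 2 + y.
  by rewrite ler_norml; apply/andP; split; lra.
have y2 : 1 <= 2 + y by lra.
apply: ler_pM => //.
  by apply: lerXn2r; rewrite ?nnegrE//; lra.
have w0 : 0 < 1 + `|y| `^ a by rewrite ltr_pwDl ?powR_ge0.
have M0 : 0 <= M by exact: le_trans (fM 0).
have := fM y; rewrite normrM normfV (gtr0_norm w0) mulrC ler_pdivrMr// => /le_trans.
apply; rewrite -mulrA ler_wpM2l//.
have : `|y| `^ a <= (2 + y) ^+ k.
  rewrite -powR_mulrn; last lra.
  apply: (@le_trans _ _ ((2 + y) `^ a)); last exact: ler_powR.
  by apply: ge0_ler_powR; rewrite ?nnegrE//; lra.
have : 1 <= (2 + y) ^+ k by exact: exprn_ege1.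
lra.
Qed.

(** The common end of all four converse inclusions: for each class it remains to show that a Stein
    operator annihilates polynomials in expectation. *)
Lemma chi2_annihilator_right_ideal (S : weyl R) :
  (forall p : {poly R}, stein_identity Y S (fun t => horner (derivn t p))) ->
  right_ideal1 G S.
Proof.
move=> hS.
have lamE (L : weyl R) :
    (forall p : {poly R}, stein_identity Y L (fun t => horner (derivn t p))) ->
    forall p, (\int[P]_w (wpact L p).[Y w])%R = 0.
  move=> hL p; have [_] := hL p.
  rewrite unlock /Rintegral; under eq_fun do rewrite weyl_apply_horner.
  by move=> ->.
apply: (@chi2_annihilator _ (fun p => \int[P]_w p.[Y w])%R).
- move=> a u v.
  under [LHS]eq_Rintegral do rewrite hornerD hornerZ.
  rewrite RintegralD//; last 2 first.
  + by under eq_fun do rewrite -hornerZ; exact: integrable_poly_chi2.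
  + exact: integrable_poly_chi2.
  by rewrite RintegralZl//; exact: integrable_poly_chi2.
- rewrite (_ : (\int[P]_w _)%R = 1) ?oner_eq0//.
  under eq_Rintegral do rewrite hornerC.
  rewrite Rintegral_cst// mul1r; exact: (congr1 fine (probability_setT P)).
- apply: lamE => p.
  (* [G] lies in its own right ideal, so the inclusion already proved shows that the expectation
     kills the image of [G]. *)
  have : right_ideal1 G G by exists 1; rewrite ?mulr1.
  move/right_ideal_PSO_slow_growth => /(_ (horner p)).
  rewrite /= => /(_ (polynomial_fun_slow_growth _)).
  under eq_fun do rewrite derive1n_horner.
  by apply; exists p.
- exact: lamE.
Qed.

End chi2_classes.

(** * Gaussian cutoffs of polynomials, as Schwartz functions *)

Section gaussian_cutoff.
Context {R : realType}.
Implicit Types (e x y : R) (p q : {poly R}).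

Definition gauss_cutoff e p : R -> R := fun x => p.[x] * expR (- (e * x ^+ 2)).

(** Differentiation conjugated by the Gaussian factor, acting on the polynomial factor alone. *)
Definition gauss_deriv e p : {poly R} := deriv p - (2 * e) *: ('X * p).

Lemma is_derive_gauss_cutoff e p x :
  is_derive x (1 : R) (gauss_cutoff e p) (gauss_cutoff e (gauss_deriv e p) x).
Proof.
have dq : is_derive x (1 : R) (horner (- e *: 'X^2)) (- (2 * e * x)).
  apply: is_derive_eq; rewrite derivZ derivXn hornerZ hornerMn hornerXn expr1.
  by rewrite mulrnAr -mulr_natl; ring.
have -> : gauss_cutoff e p = horner p * (expR \o horner (- e *: 'X^2)).
  apply/funext => z; rewrite fctE/= /gauss_cutoff hornerZ hornerXn.
  by rewrite mulNr.
apply: is_derive_eq.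
rewrite /gauss_cutoff /gauss_deriv /GRing.scale/=.
rewrite !(hornerD, hornerN, hornerZ, hornerM, hornerX, hornerXn) mulNr; ring.
Qed.

Lemma derive1n_gauss_cutoff e p t :
  derive1n t (gauss_cutoff e p) = gauss_cutoff e (iter t (gauss_deriv e) p).
Proof.
elim: t => [|t IH]; first by rewrite derive1n0.
rewrite derive1nS IH; apply/funext => x; rewrite derive1E.
by apply: derive_val; exact: is_derive_gauss_cutoff.
Qed.

Lemma schwartz_gauss_cutoff e p : 0 < e -> schwartz (gauss_cutoff e p).
Proof.
move=> e0; split.
  move=> n x; rewrite derive1n_gauss_cutoff.
  by have := is_derive_gauss_cutoff e (iter n (gauss_deriv e) p) x => -[].
move=> j t; rewrite derive1n_gauss_cutoff; set q := iter _ _ _.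
have [C C0 hC] := poly_growth ('X^j * q).
have [D D0 hD] := expR_dominates_pow (size ('X^j * q)) e0.
exists (C * D) => x; rewrite /gauss_cutoff mulrA -hornerXn -hornerM normrM.
rewrite (ger0_norm (expR_ge0 _)) expRN ler_pdivrMr ?expR_gt0//.
apply: le_trans (hC x) _; rewrite -mulrA ler_wpM2l//.
exact/hD/sqr_ge0.
Qed.

(** The outer variable of [Q] is the cutoff parameter e. Polynomial dependence on e yields both the
    limit at e = 0 and a bound uniform for e in [0, 1]. *)
Lemma iter_gauss_deriv p t :
  exists2 Q : {poly {poly R}}, Q.[0] = derivn t p &
    forall e, iter t (gauss_deriv e) p = Q.[e%:P].
Proof.
elim: t => [|t [Q Q0 QE]].
  by exists p%:P => [|e]; rewrite hornerC.
exists (map_poly (@deriv R) Q - 'X * (2 *: ('X : {poly R}))%:P * Q).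
  rewrite derivnS -Q0 !(hornerD, hornerN, hornerM, hornerX) !mul0r subr0.
  by rewrite !horner_coef0 coef_map.
move=> e /=; rewrite QE /gauss_deriv.
rewrite !(hornerD, hornerN, hornerM, hornerX, hornerC); congr (_ - _).
  rewrite (horner_coef_wide _ (size_poly _ _)) horner_coef raddf_sum/=.
  apply: eq_bigr => i _; rewrite coef_map/= -polyC_exp derivM derivC mulr0.
  by rewrite addr0.
rewrite -!mul_polyC polyCM; ring.
Qed.

End gaussian_cutoff.

Section cutoff_limit.
Context {R : realType} d (T : measurableType d) (P : probability T R).
Variables (N Y : {RV P >-> R}).
Hypothesis N_normal : forall A : set R, measurable A ->
  distribution P N A = normal_prob (0 : R) (1 : R) A.
Hypothesis Y_def : forall w, Y w = N w ^+ 2 - 1.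

Lemma weyl_apply_gauss_cutoff (S : weyl R) (p : {poly R}) :
  exists2 W : {poly {poly R}}, W.[0] = wpact S p &
    forall e y, weyl_apply S (fun t => derive1n t (gauss_cutoff e p)) y =
      (W.[e%:P]).[y] * expR (- (e * y ^+ 2)).
Proof.
pose Q t := projT1 (cid2 (iter_gauss_deriv p t)).
have Q0 t : (Q t).[0] = derivn t p by rewrite /Q; case: cid2.
have QE t e : iter t (gauss_deriv e) p = (Q t).[e%:P] by rewrite /Q; case: cid2.
exists (\sum_(t < size S) (S`_t)%:P * Q t).
  by rewrite horner_sum; apply: eq_bigr => t _; rewrite hornerM hornerC Q0.
move=> e y; rewrite !horner_sum mulr_suml; apply: eq_bigr => t _.
by rewrite derive1n_gauss_cutoff /gauss_cutoff QE !hornerM hornerC mulrA.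
Qed.

(** Dominated convergence along e = 1 / (n + 1): the Gaussian factor is at most 1 and e <= 1, so the
    sum of the |W_i(Y)| is an integrable bound. *)
Lemma PSO_schwartz_poly (S : weyl R) : PSO Y schwartz S ->
  forall p : {poly R}, stein_identity Y S (fun t => horner (derivn t p)).
Proof.
move=> hS p; split.
  under eq_fun do rewrite weyl_apply_horner.
  exact: (integrable_poly_chi2 N_normal Y_def).
have [W W0 WE] := weyl_apply_gauss_cutoff S p.
rewrite unlock; under eq_integral do rewrite weyl_apply_horner.
pose e n : R := n.+1%:R^-1.
have e0 n : 0 < e n by rewrite invr_gt0 ltr0n.
have e1 n : e n <= 1 by rewrite invf_le1 ?ltr0n// ler1n.
pose f n w := (W.[(e n)%:P]).[Y w] * expR (- (e n * Y w ^+ 2)).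
have If n : P.-integrable setT (fun w => (f n w)%:E) /\ (\int[P]_w (f n w)%:E = 0)%E.
  have [iS ES] := hS _ (schwartz_gauss_cutoff p (e0 n)).
  split; first by move: iS; under eq_fun do rewrite WE.
  by rewrite -[RHS]ES unlock; apply: eq_integral => w _; rewrite WE.
(* Evaluating the inner variable at [Y w] first leaves a real polynomial in e, whose continuity at 0
   gives the pointwise limit. *)
have fE n w : f n w = ((map_poly (horner_eval (Y w)) W).[e n]) * expR (- (e n * Y w ^+ 2)).
  congr (_ * _).
  by have := horner_map (horner_eval (Y w)) W (e n)%:P; rewrite /= /horner_eval hornerC.
have cvgf w : f n w @[n --> \oo] --> (wpact S p).[Y w].
  pose V := map_poly (horner_eval (Y w)) W.
  have V0 : (wpact S p).[Y w] = V.[0] * (expR \o horner (- (Y w ^+ 2) *: 'X)) 0.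
    rewrite /= hornerZ hornerX mulr0 expR0 mulr1 -W0.
    by have := horner_map (horner_eval (Y w)) W 0; rewrite /= rmorph0 /horner_eval => ->.
  rewrite V0.
  have -> : f ^~ w = (fun x => V.[x] * (expR \o horner (- (Y w ^+ 2) *: 'X)) x) \o e.
    by apply/funext => n; rewrite fE /= hornerZ hornerX mulNr [e n * _]mulrC.
  have ecvg : e n @[n --> \oo] --> (0 : R) by exact: cvg_harmonic.
  apply: (cvg_comp _ _ ecvg); apply: cvgM; first exact: continuous_horner.
  apply: continuous_comp; first exact: continuous_horner.
  exact: continuous_expR.
have cvgI : (\int[P]_w (f n w)%:E)%E @[n --> \oo] --> (\int[P]_w ((wpact S p).[Y w])%:E)%E.
  apply: (@dominated_cvg _ _ _ _ _ _ _ _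
    (fun w => (\sum_(i < size W) `|(W`_i).[Y w]|%:E)%E)) => //.
  - by move=> n; have [/integrableP[]] := If n.
  - move=> w _; apply: cvg_EFin; first exact: nearW.
    exact: cvgf.
  - by move=> w _; rewrite sumEFin.
  - apply: integrable_sum => // i _.
    exact/integrable_norm/(integrable_poly_chi2 N_normal Y_def).
  - move=> n w _; rewrite abse_EFin sumEFin lee_fin normrM.
    rewrite (ger0_norm (expR_ge0 _)) (@le_trans _ _ (`|(W.[(e n)%:P]).[Y w]|))//.
      by rewrite ler_piMr// -expR0 ler_expR oppr_le0 mulr_ge0 ?sqr_ge0// ltW.
    rewrite [W.[_]]horner_coef horner_sum (le_trans (ler_norm_sum _ _ _))//.
    apply: ler_sum => i _; rewrite hornerM -polyC_exp hornerC normrM ler_piMr//.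
    by rewrite normrX exprn_ile1// ger0_norm// ltW.
have : (\int[P]_w (f n w)%:E)%E @[n --> \oo] --> (0 : \bar R)%E.
  by under eq_fun do rewrite (If _).2; exact: cvg_cst.
by move/(cvg_unique _ cvgI); apply.
Qed.

End cutoff_limit.

(** * Derivatives relative to the half-line from -1 *)

Section half_line.
Context {R : realType}.
Local Notation I := [set y : R | -1 <= y].
Implicit Types (f g : R -> R) (x y : R).

Lemma cvg_dnbhs_injective g x : {for x, continuous g} -> injective g ->
  g @ x^' --> (g x)^'.
Proof.
move=> cg ig A gA.
have {gA} : \forall y \near x, g y != g x -> A (g y) by exact: cg gA.
rewrite -[_ A]/(\forall y \near x, y != x -> A (g y)).
by apply: filterS => y h yx; apply: h; apply: contra_neq yx => /ig.
Qed.

(** Links the increment form of [is_derive] to the two-point form of [derive1_within]. Translations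
    are injective, so they respect punctured neighbourhoods. *)
Lemma cvg_difference_quotient f x (l : R) :
  h^-1 * (f (h + x) - f x) @[h --> 0^'] --> l <->
  (f y - f x) / (y - x) @[y --> x^'] --> l.
Proof.
split => fl.
- have sx : (fun y => y - x) @ x^' --> (0 : R)^'.
    rewrite -(subrr x); apply: (@cvg_dnbhs_injective (fun y => y - x)).
      by apply: cvgB; [exact: cvg_id | exact: cvg_cst].
    exact: addIr.
  have := cvg_comp _ _ sx fl; apply: cvg_trans; apply: near_eq_cvg.
  by near=> y; rewrite /= subrK mulrC.
- have sx : (fun h => h + x) @ (0 : R)^' --> x^'.
    rewrite -[X in _ --> X^'](add0r x).
    apply: (@cvg_dnbhs_injective (fun h => h + x)).
      by apply: cvgD; [exact: cvg_id | exact: cvg_cst].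
    exact: addIr.
  have := cvg_comp _ _ sx fl; apply: cvg_trans; apply: near_eq_cvg.
  by near=> y; rewrite /= addrK mulrC.
Unshelve. all: by end_near. Qed.

Lemma is_derive_difference_quotient f x (l : R) :
  is_derive x (1 : R) f l -> (f y - f x) / (y - x) @[y --> x^'] --> l.
Proof.
move=> [df fl]; apply/cvg_difference_quotient.
move: df; rewrite /derivable -[X in cvg X -> _]/(_ @ _) => /cvg_ex[l' dl'].
have : h^-1 *: ((f \o shift x) (h *: (1 : R)) - f x) @[h --> 0^'] --> l.
  by rewrite -fl; exact: cvgP dl'.
rewrite (_ : (fun _ => _) = (fun h => h^-1 * (f (h + x) - f x)))//.
by apply/funext => h /=; rewrite /GRing.scale/= mulr1.
Qed.

Lemma dnbhs_within_half_line x : -1 < x -> within I x^' = x^'.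
Proof.
move=> x1; apply/funext => A; apply/propext; split => [h|]; last first.
  by apply: filterS => y Ay _.
rewrite /within/= in h.
have hI : \forall y \near x^', I y.
  by apply: nbhs_dnbhs; near=> y; rewrite /= ltW//; near: y; exact: lt_nbhsr.
by apply: filterS2 h hI => y h /h.
Unshelve. all: by end_near. Qed.

(** Points to the right of x stay in the half-line, also at the endpoint. Properness makes the limit
    that defines [derive1_within] unique. *)
Lemma within_half_line_proper x : -1 <= x -> ProperFilter (within I x^').
Proof.
move=> x1; apply: Build_ProperFilter_ex => A h.
have hA : \forall y \near x, y != x -> I y -> A y by exact: h.
have : \forall y \near x^'+, A y.
  rewrite near_withinE; apply: filterS hA => y h' xy.
  by apply: h'; rewrite ?gt_eqF//= ltW// (le_lt_trans x1).
by move=> /(@filter_ex _ _ (at_right_proper_filter x)).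

Qed.

Lemma derive1n_within_horner (p : {poly R}) t x : -1 <= x ->
  derive1n_within I t (horner p) x = (derivn t p).[x] /\
  (derive1n_within I t (horner p) y - derive1n_within I t (horner p) x) / (y - x)
     @[y --> within I x^'] --> (derivn t.+1 p).[x].
Proof.
(* The quotient only sees points of the half-line, so agreement with the polynomial there is enough,
   and restricting the filter preserves the two-sided limit. *)
have quot u z : -1 <= z -> {in I, derive1n_within I u (horner p) =1 horner (derivn u p)} ->
    (derive1n_within I u (horner p) y - derive1n_within I u (horner p) z) / (y - z)
     @[y --> within I z^'] --> (derivn u.+1 p).[z].
  move=> z1 uE; rewrite uE ?inE// derivnS.
  have dz : is_derive z (1 : R) (horner (derivn u p)) (deriv (derivn u p)).[z].
    exact: is_derive_poly.
  have := is_derive_difference_quotient dz => h.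
  have : ((derivn u p).[y] - (derivn u p).[z]) / (y - z) @[y --> within I z^'] -->
      (deriv (derivn u p)).[z].
    by apply: cvg_trans h; apply: cvg_app; exact: cvg_within.
  apply: cvg_trans; apply: near_eq_cvg; rewrite near_withinE; near=> y => yI.
  by rewrite uE ?inE.
suff E : {in I, derive1n_within I t (horner p) =1 horner (derivn t p)}.
  by move=> x1; split; [apply: E; rewrite inE | exact: quot].
elim: t => [|t IH] z; rewrite inE => z1; first by [].
have := quot t z z1 IH => /cvg_lim; apply => //.
exact: within_half_line_proper.
Unshelve. all: by end_near. Qed.

Lemma continuous_within_sqrB1 f : {within I, continuous f} ->
  continuous (fun x => f (x ^+ 2 - 1)).
Proof.
move=> /subspace_continuousP cf x.
have x1 : I (x ^+ 2 - 1) by rewrite /= lerBrDr addNr sqr_ge0.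
have := cf _ x1; apply: cvg_comp.
have csq : (fun z : R => z ^+ 2 - 1) @ x --> x ^+ 2 - 1.
  by apply: cvgB; [exact: exprn_continuous | exact: cvg_cst].
move=> A hA.
have {hA} : \forall z \near x, I (z ^+ 2 - 1) -> A (z ^+ 2 - 1) by exact: csq hA.
rewrite -[_ A]/(\forall z \near x, A (z ^+ 2 - 1)).
by apply: filterS => z; apply; rewrite /= lerBrDr addNr sqr_ge0.
Qed.

End half_line.

(** * The support of [Y] and the operator-dependent class *)

Section operator_class.
Context {R : realType} d (T : measurableType d) (P : probability T R).
Variables (N Y : {RV P >-> R}).
Hypothesis N_normal : forall A : set R, measurable A ->
  distribution P N A = normal_prob (0 : R) (1 : R) A.
Hypothesis Y_def : forall w, Y w = N w ^+ 2 - 1.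
Local Notation G := (chi2_gen R).
Local Notation I := [set y : R | -1 <= y].

(** On an interval of radius r around a inside V, |x| <= |a| + r bounds the density below by the
    positive constant [c]. *)
Lemma normal_prob_open_gt0 (V : set R) (a : R) : open V -> V a ->
  (0 < normal_prob (0 : R) (1 : R) V)%E.
Proof.
move=> oV Va.
have /nbhs_ballP[r /= r0 rV] : nbhs a V by exact: open_nbhs_nbhs.
pose D : set R := [set` `]a - r, a + r[].
have DV : D `<=` V.
  move=> x; rewrite /D/= in_itv/= => /andP[ax xa]; apply: rV.
  by rewrite /ball/= ltr_norml; apply/andP; split; lra.
have mV : measurable V by exact: open_measurable.
have mD : measurable D by exact: measurable_itv.
pose c : R := normal_peak 1 * expR (- (`|a| + r) ^+ 2 / 2).
have c0 : 0 < c by rewrite mulr_gt0 ?expR_gt0 ?normal_peak_gt0 ?oner_eq0.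
apply: (@lt_le_trans _ _ (normal_prob 0 1 D)); last first.
  by apply: le_measure; rewrite ?inE.
apply: (@lt_le_trans _ _ (\int[lebesgue_measure]_(x in D) c%:E)%E).
  rewrite integral_cst//= lebesgue_measure_itv/= lte_fin.
  by rewrite ifT; [rewrite -EFinM lte_fin mulr_gt0//; lra | lra].
apply: ge0_le_integral => //=.
- by move=> x _; rewrite lee_fin ltW.
- by apply/measurable_EFinP; apply: measurable_funTS; exact: measurable_normal_pdf.
move=> x; rewrite /D/= in_itv/= => /andP[ax xa]; rewrite lee_fin.
rewrite normal_pdfE ?oner_eq0// /normal_fun subr0 expr1n ler_wpM2l ?normal_peak_ge0//.
rewrite ler_expR !mulNr lerN2 ler_wpM2r//.
rewrite -(real_normK (num_real x)); apply: lerXn2r; rewrite ?nnegrE ?addr_ge0// ?ltW//.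
have : `|x - a| < r by rewrite ltr_norml; apply/andP; split; lra.
have := ler_normD (x - a) a; rewrite subrK; lra.
Qed.

(** Below -1 an open half-line has empty preimage. For x >= -1, pulling an open neighbourhood of x
    back along z^2 - 1 gives an open set that contains the square root of x + 1. *)
Lemma rv_support_chi2 : rv_support Y = I.
Proof.
apply/seteqP; split => x /=.
  move=> xs; rewrite leNgt; apply/negP => x1.
  have := xs [set` `]-oo, (-1)[] (interval_open _ _).
  rewrite /= in_itv/= => /(_ isT isT x1).
  rewrite /distribution /pushforward (_ : _ @^-1` _ = set0) ?measure0 ?ltxx//.
  apply/seteqP; split => w //=; rewrite in_itv/= Y_def.
  by have := sqr_ge0 (N w); lra.
move=> x1 U oU Ux.
pose V := (fun z : R => z ^+ 2 - 1) @^-1` U.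
have oV : open V.
  apply: open_comp oU => z _.
  by apply: cvgB; [exact: exprn_continuous | exact: cvg_cst].
have -> : distribution P Y U = distribution P N V.
  rewrite /distribution /pushforward /V; congr (P _).
  by apply/seteqP; split => w /=; rewrite Y_def.
rewrite N_normal; last exact: open_measurable.
apply: (@normal_prob_open_gt0 _ (Num.sqrt (x + 1))) => //.
by rewrite /V/= sqr_sqrtr ?addrK//; lra.
Qed.

(** Polynomials belong to the class of every operator, so although the class varies with S, they
    remain available as test functions. *)
Lemma operator_class_horner (S : weyl R) (p : {poly R}) :
  operator_class Y S (horner p).
Proof.
split; rewrite rv_support_chi2.
  split.
    move=> t x _ x1.
    by have [_ h] := derive1n_within_horner p t x1; apply: cvgP h.
  move=> t _; apply/subspace_continuousP => x x1.
  suff : derive1n_within I t (horner p) y @[y --> within I (nbhs x)] -->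
      derive1n_within I t (horner p) x by [].
  have [-> _] := derive1n_within_horner p t x1.
  have h : horner (derivn t p) @ within I (nbhs x) --> (derivn t p).[x].
    apply: cvg_trans (@continuous_horner R (derivn t p) x).
    by apply: cvg_app; exact: cvg_within.
  apply: (cvg_trans _ h); apply: near_eq_cvg; rewrite near_withinE; near=> y => yI.
  by have [-> _] := derive1n_within_horner p t yI.
move=> j t _ _.
have h w : Y w ^+ j * derive1n_within I t (horner p) (Y w) = ('X^j * derivn t p).[Y w].
  have /(derive1n_within_horner p t)[-> _] : -1 <= Y w.
    by rewrite Y_def lerBrDr addNr sqr_ge0.
  by rewrite hornerM hornerXn.
under eq_fun do rewrite h.
exact: (integrable_poly_chi2 N_normal Y_def).
Unshelve. all: by end_near. Qed.

Lemma PSO_operator_class_poly (S : weyl R) : PSO_operator_class Y S ->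
  forall p : {poly R}, stein_identity Y S (fun t => horner (derivn t p)).
Proof.
move=> hS p; have [] := hS _ (operator_class_horner S p).
have E w : weyl_apply S (fun t => derive1n_within (rv_support Y) t (horner p)) (Y w) =
    weyl_apply S (fun t => horner (derivn t p)) (Y w).
  apply: eq_bigr => t _; rewrite rv_support_chi2.
  have /(derive1n_within_horner p t)[-> _] // : -1 <= Y w.
  by rewrite Y_def lerBrDr addNr sqr_ge0.
move=> iS ES; split; first by move: iS; under eq_fun do rewrite E.
by rewrite -[RHS]ES; congr expectation; apply/funext => w; rewrite E.
Qed.

Lemma right_ideal_PSO_operator_class : right_ideal1 G `<=` PSO_operator_class Y.
Proof.
move=> _ [L _ <-] f [[]]; rewrite rv_support_chi2 => cvf cf intf.
apply: (stein_identity_gen N_normal Y_def).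
(* At an interior point the relative punctured filter is the ordinary one, so the relative
   derivative is a genuine derivative. *)
- move=> t y tn y1; apply/is_derive_cvg/cvg_difference_quotient.
  have := cvf t y tn (ltW y1); rewrite [derive1n_within _ t.+1 f y]/derive1_within/=.
  by rewrite dnbhs_within_half_line.
- by move=> t tn; apply: continuous_within_sqrB1; exact: cf.
- exact: intf.
Qed.

End operator_class.

Theorem proposition3p3 (R : realType) (d : measure_display)
    (T : measurableType d) (P : probability T R) (N : {RV P >-> R})
    (N_normal : forall A : set R, measurable A ->
       distribution P N A = normal_prob (0 : R) (1 : R) A)
    (Y : {RV P >-> R}) (Y_def : forall w : T, Y w = N w ^+ 2 - 1) :
  let G : weyl R := - weyl_y + 2 * (weyl_y + 1) * weyl_d in
  [/\ PSO Y schwartz = right_ideal1 G,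
      PSO Y polynomial_fun = right_ideal1 G,
      PSO Y slow_growth = right_ideal1 G
    & PSO_operator_class Y = right_ideal1 G].
Proof.
move=> G; rewrite [G](_ : _ = chi2_gen R)//.
have ideal S := @chi2_annihilator_right_ideal _ _ _ _ N Y N_normal Y_def S.
have slow := right_ideal_PSO_slow_growth N_normal Y_def.
have poly_ideal : PSO Y polynomial_fun `<=` right_ideal1 (chi2_gen R).
  move=> S hS; apply: ideal => p; have := hS _ (ex_intro _ p erefl).
  by under eq_fun do rewrite derive1n_horner.
(* Enlarging the test class shrinks the set of operators. The slow-growth class contains Schwartz
   functions and polynomials, so it passes the ideal inclusion on to both, and inherits the converse
   from polynomials. *)
split; apply/seteqP; split.
- by move=> S /(PSO_schwartz_poly N_normal Y_def); exact: ideal.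
- exact: (subset_trans slow (PSO_subset (@schwartz_slow_growth R))).
- exact: poly_ideal.
- exact: (subset_trans slow (PSO_subset (@polynomial_fun_slow_growth R))).
- exact: (subset_trans (PSO_subset (@polynomial_fun_slow_growth R)) poly_ideal).
- exact: slow.
- by move=> S /(PSO_operator_class_poly N_normal Y_def); exact: ideal.
- exact: right_ideal_PSO_operator_class N_normal Y_def.
Qed.
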